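(* Let $G=L\ltimes U$ be an algebra group extension over $\mathbb{F}_q$, with $U=1+J$. Then the system of characters $\{\chi''_\alpha:\ \alpha\in\mathcal{A}''\}$ together with the system of subsets $\{K''_\beta:\ \beta\in\mathcal{B}''\}$ is a supercharacter theory of the group $G$.
   Context: **Supercharacter theory.** A supercharacter theory of a finite group $G$ is a pair $(\mathfrak{S},\mathcal{K})$, where $\mathfrak{S}=\{\chi_1,\dots,\chi_m\}$ is a system of pairwise orthogonal complex characters of $G$ and $\mathcal{K}=\{K_1,\dots,K_m\}$ is a partition of $G$ (the same number $m$ of characters and of classes), such that each $\chi_i$ is constant on each $K_j$ and $\{1\}\in\mathcal{K}$. **Algebra group extension.** Let $\mathbb{F}_q$ be a finite field and $J$ a finite-dimensional associative nilpotent $\mathbb{F}_q$-algebra; $U=1+J$ is the group with multiplication $(1+x)(1+y)=1+x+y+xy$. Let $L$ be a finite group with an $\mathbb{F}_q$-linear left action and an $\mathbb{F}_q$-linear right action on $J$ which commute with each other and satisfy $h(xy)=(hx)y$, $(xy)h=x(yh)$, $x(hy)=(xh)y$ for all $x,y\in J$, $h\in L$. Then $\mathrm{Ad}_h(1+x)=1+hxh^{-1}$ defines a homomorphism $\mathrm{Ad}:L\to\mathrm{Aut}(U)$, and $G=L\ltimes U$ is the corresponding semidirect product. Each element of $G$ is uniquely $g=h(1+x)$, $h\in L$, $x\in J$. The group $G$ acts on $J$ on the left and on the right: for $g=hu$ ($h\in L$, $u\in U$), $gx=h(ux)$ and $xg=(xh)u$, where $(1+y)x=x+yx$, $x(1+y)=x+xy$.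 On the dual space $J^*$, $G$ acts on the left by $(g\lambda)(x)=\lambda(xg)$ and on the right by $(\lambda g)(x)=\lambda(gx)$; for $h\in L$ put $\mathrm{Ad}^*_h(\lambda)=h\lambda h^{-1}$ and, on $J$, $\mathrm{Ad}_h(x)=hxh^{-1}$. **Characters.** Fix a nontrivial character $t\mapsto\varepsilon^t$ of the additive group of $\mathbb{F}_q$ with values in $\mathbb{C}^*$. For $\lambda\in J^*$ let $J_{\lambda,\mathrm{right}}=\{y\in J:\ \lambda(yx)=0 \text{ for all } x\in J\}$ and $U_{\lambda,\mathrm{right}}=1+J_{\lambda,\mathrm{right}}$. The $U\times U$ orbit of $\lambda$ in $J^*$ is $U\lambda U$. Let $H_{U\lambda U}=\{h\in L:\ \mathrm{Ad}^*_h(\mu)=\mu \text{ for all }\mu\in U\lambda U\}$ and $S_{U\lambda U}=\{r\in L:\ \mathrm{Ad}_r^*(U\lambda U)=U\lambda U\}$; $H_{U\lambda U}$ is normal in $S_{U\lambda U}$, and both depend only on the orbit. For a normal subgroup $N$ of a group $S$, an $S$-irreducible character of $N$ is the sum of the distinct irreducible complex characters of $N$ in one $S$-conjugation orbit. Let $\mathcal{A}''_0$ be the set of pairs $(\theta,\lambda)$, where $\lambda$ runs through representatives of the $U\times U$ orbits in $J^*$ (so $\lambda$ stands for the orbit $U\lambda U$) and $\theta$ runs through the $S_{U\lambda U}$-irreducible characters of $H_{U\lambda U}$. The group $L$ acts on $\mathcal{A}''_0$ by conjugation: $r\in L$ sends the orbit $U\lambda U$ to $r(U\lambda U)r^{-1}$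 and $\theta$ to the character $h\mapsto\theta(r^{-1}hr)$ of $rH_{U\lambda U}r^{-1}$. Let $\mathcal{A}''$ be the set of $L$-orbits in $\mathcal{A}''_0$. For $\alpha\in\mathcal{A}''$ represented by $(\theta,\lambda)$ put $H_0=H_{U\lambda U}$ and $G_{0,\lambda}=H_0\ltimes U_{\lambda,\mathrm{right}}$; the formula $\xi_{\theta,\lambda}(h(1+x))=\theta(h)\varepsilon^{\lambda(x)}$ ($h\in H_0$, $x\in J_{\lambda,\mathrm{right}}$) defines a character of $G_{0,\lambda}$, and $\chi''_\alpha$ is the character of $G$ induced from $\xi_{\theta,\lambda}$. **Classes.** For $h\in L$, let $J''_h$ be the least two-sided ideal of $J$ such that $\mathrm{Ad}^*_h$ acts as the identity on its orthogonal complement in $J^*$ (equivalently, such that $\mathrm{Ad}_h$ acts as the identity on $J/J''_h$). Let $\pi''_h:J\to J/J''_h$ be the natural projection. Let $\mathcal{B}''_0$ be the set of pairs $(h,\omega)$, where $h\in L$ and $\omega$ is a $U\times U$ orbit in $J/J''_h$ (left and right multiplication). The group $L$ acts on $\mathcal{B}''_0$ by conjugation, $r\cdot(h,\omega)=(rhr^{-1},r\omega r^{-1})$ (note $rJ''_hr^{-1}=J''_{rhr^{-1}}$); let $\mathcal{B}''$ be the set of $L$-orbits. For $\beta\in\mathcal{B}''$ represented by $(h,\omega)$ put $K''_\beta=\bigcup_{p\in L}p\,\bigl(h(1+(\pi''_h)^{-1}(\omega))\bigr)\,p^{-1}$. *)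

(* Defs.v *)
From HB Require Import structures.
From mathcomp Require Import all_boot all_order all_algebra.
From mathcomp Require Import all_fingroup all_solvable all_field all_character.

Set Implicit Arguments.
Unset Strict Implicit.
Unset Printing Implicit Defensive.

Import GRing.Theory.
Local Open Scope ring_scope.

(* The library's character theory takes values in algC, the field of algebraic
   complex numbers, which contains all values of complex characters of finite
   groups. *)

(* S and K list the members of two indexed families of equal length;
   [pairwise_orthogonal S] also says that S has no repetition and no zero. *)
Definition supercharacter_theory (gT : finGroupType) (G : {group gT})
    (S : seq 'CF(G)) (K : seq {set gT}) : Prop :=
  [/\ {subset S <= character} /\ pairwise_orthogonal S,
      uniq K /\ partition [set:: K] G,
      size S = size K,
      forall chi B, chi \in S -> B \in K -> {in B &, forall g k, chi g = chi k}
    & [set 1%g] \in K].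

(* Over a finite field, finite-dimensional means finite. Nilpotency says that
   all products of a fixed number of factors vanish. *)
Record nilAlgebra (F : finFieldType) := NilAlgebra {
  nil_carrier :> finLmodType F;
  jmul : nil_carrier -> nil_carrier -> nil_carrier;
  jmulA : associative jmul;
  jmul_linear_l : forall y, linear (jmul^~ y);
  jmul_linear_r : forall x, linear (jmul x);
  jmul_nilpotent : exists n, forall x (s : seq nil_carrier),
    size s = n -> foldl jmul x s = 0
}.

Local Notation "x ** y" := (jmul x y) (at level 40, left associativity).

(* The group 1 + J; [OnePlus x] stands for 1 + x. *)
Record algebraGroup (F : finFieldType) (J : nilAlgebra F) :=
  OnePlus { minus_one : J }.

Arguments OnePlus {F J} minus_one.

Record algebraGroupExt (F : finFieldType) (L : finGroupType)
    (J : nilAlgebra F) := AlgebraGroupExt {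
  lact : L -> J -> J;
  ract : J -> L -> J;
  lact_linear : forall h, linear (lact h);
  ract_linear : forall h, linear (ract^~ h);
  lact1 : forall x, lact 1%g x = x;
  lactM : forall h k x, lact (h * k)%g x = lact h (lact k x);
  ract1 : forall x, ract x 1%g = x;
  ractM : forall x h k, ract x (h * k)%g = ract (ract x h) k;
  lact_ract : forall h x k, ract (lact h x) k = lact h (ract x k);
  lact_jmul : forall h x y, lact h (x ** y) = lact h x ** y;
  jmul_ract : forall x y h, ract (x ** y) h = x ** ract y h;
  jmul_lact : forall x h y, x ** lact h y = ract x h ** y
}.

Record addChar (F : finFieldType) := AddChar {
  addchar :> F -> algC;
  addchar0 : addchar 0 = 1;
  addcharD : {morph addchar : s t / s + t >-> s * t};
  addchar_nontrivial : exists t, addchar t <> 1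
}.

Lemma linear_add (F : finFieldType) (V W : lmodType F) (f : V -> W) :
  linear f -> {morph f : x y / x + y}.
Proof. by move=> lf x y; rewrite -{1}[x]scale1r lf scale1r. Qed.

Lemma linear_0 (F : finFieldType) (V W : lmodType F) (f : V -> W) :
  linear f -> f 0 = 0.
Proof. by move/linear_add=> fD; apply: (addrI (f 0)); rewrite -fD !addr0. Qed.

Section AlgebraGroup.

Variables (F : finFieldType) (J : nilAlgebra F).
Implicit Types (x y z : J).

Lemma jmulDl x y z : (x + y) ** z = x ** z + y ** z.
Proof. exact: (linear_add (jmul_linear_l z)). Qed.
Lemma jmulDr x y z : x ** (y + z) = x ** y + x ** z.
Proof. exact: (linear_add (jmul_linear_r x)). Qed.
Lemma jmul0 x : x ** 0 = 0.
Proof. exact: (linear_0 (jmul_linear_r x)). Qed.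
Lemma mul0j x : 0 ** x = 0.
Proof. exact: (linear_0 (jmul_linear_l x)). Qed.

HB.instance Definition _ := [isNew for @minus_one F J].
HB.instance Definition _ := [Finite of algebraGroup J by <:].

Definition ag_one : algebraGroup J := OnePlus 0.
Definition ag_mul (u v : algebraGroup J) :=
  let x := minus_one u in let y := minus_one v in OnePlus (x + y + x ** y).

Lemma ag_mulA : associative ag_mul.
Proof.
move=> [x] [y] [z]; rewrite /ag_mul /=; congr (OnePlus _).
rewrite !(jmulDl, jmulDr) jmulA -!addrA; congr (_ + (_ + _)).
rewrite [RHS]addrCA; congr (_ + _); rewrite [LHS]addrCA; congr (_ + _).
by rewrite addrCA.
Qed.

Lemma ag_mul1 : left_id ag_one ag_mul.
Proof. by move=> [x]; rewrite /ag_mul /= mul0j addr0 add0r. Qed.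

Lemma ag_mulI v : injective (ag_mul^~ v).
Proof.
case: v => y [x1] [x2]; rewrite /ag_mul /= => -[e].
have [n nil_n] := jmul_nilpotent J.
have mulNj (u v : J) : - u ** v = - (u ** v).
  by apply: (addrI (u ** v)); rewrite -jmulDl !subrr mul0j.
have muljN (u v : J) : u ** - v = - (u ** v).
  by apply: (addrI (u ** v)); rewrite -jmulDr !subrr jmul0.
pose d := x1 - x2; have ed : d = d ** - y.
  have{}e : x1 + x1 ** y = x2 + x2 ** y.
    by apply: (addIr y); rewrite addrAC e addrAC.
  rewrite muljN jmulDl mulNj opprB; apply/eqP.
  by rewrite subr_eq addrAC eq_sym subr_eq addrC -e.
have d0 m : foldl (@jmul F J) d (nseq m (- y)) = d.
  by elim: m => //= m IHm; rewrite -ed.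
by congr (OnePlus _); apply: subr0_eq; rewrite -/d -(d0 n) nil_n ?size_nseq.
Qed.

Definition ag_inv u := invF (@ag_mulI u) ag_one.

Lemma ag_mulV : left_inverse ag_one ag_inv ag_mul.
Proof. by move=> u; rewrite /ag_inv (f_invF (@ag_mulI u)). Qed.

HB.instance Definition _ :=
  Finite_isGroup.Build (algebraGroup J) ag_mulA ag_mul1 ag_mulV.

End AlgebraGroup.

Section Dual.

Variables (F : finFieldType) (J : nilAlgebra F).

Definition is_functional (f : {ffun J -> F}) :=
  [forall a, forall x, forall y, f (a *: x + y) == a * f x + f y].

Record dual := Dual { dual_val : {ffun J -> F}; _ : is_functional dual_val }.

HB.instance Definition _ := [isSub for dual_val].
HB.instance Definition _ := [Finite of dual by <:].

Definition dual_fun (lam : dual) : J -> F := dual_val lam.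
Coercion dual_fun : dual >-> Funclass.

Lemma dual_linear (lam : dual) a x y : lam (a *: x + y) = a * lam x + lam y.
Proof.
by rewrite /dual_fun; case: lam => f /= /forallP/(_ a)/forallP/(_ x)/forallP/(_ y)/eqP.
Qed.

Fact dual_comp_subproof (lam : dual) (f : J -> J) :
  linear f -> is_functional [ffun x => lam (f x)].
Proof.
move=> lf; apply/forallP=> a; apply/forallP=> x; apply/forallP=> y.
by rewrite !ffunE lf dual_linear.
Qed.

Definition dual_comp lam f lf := Dual (@dual_comp_subproof lam f lf).

Lemma dual_compE lam f lf x : @dual_comp lam f lf x = lam (f x).
Proof. by rewrite /dual_fun ffunE. Qed.

Lemma dual_eqP (lam mu : dual) : lam =1 mu -> lam = mu.
Proof. by move=> e; apply/val_inj/ffunP. Qed.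

Lemma dualD (lam : dual) x y : lam (x + y) = lam x + lam y.
Proof. by rewrite -{1}[x]scale1r dual_linear mul1r. Qed.

Lemma dual0 (lam : dual) : lam 0 = 0.
Proof. by apply: (addrI (lam 0)); rewrite -dualD !addr0. Qed.

Implicit Types (u v : algebraGroup J) (x y : J) (lam : dual).

Definition uJ u x := x + minus_one u ** x.
Definition Ju x u := x + x ** minus_one u.

Lemma uJ_linear u : linear (uJ u).
Proof.
by move=> a x y; rewrite /uJ jmul_linear_r scalerDr addrACA.
Qed.

Lemma Ju_linear u : linear (Ju^~ u).
Proof.
by move=> a x y; rewrite /Ju (jmul_linear_l (minus_one u)) scalerDr addrACA.
Qed.

(* (u lam)(x) = lam(x u) and (lam u)(x) = lam(u x). *)
Definition uD u lam := dual_comp lam (Ju_linear u).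
Definition Du lam u := dual_comp lam (uJ_linear u).

Definition UlamU lam := [set Du (uD u lam) v | u : algebraGroup J, v : algebraGroup J].

Definition dual_orbits := [set UlamU lam | lam : dual].

Definition Jright lam := [set y : J | [forall x, lam (y ** x) == 0]].

Definition is_ideal (I : {set J}) :=
  [&& 0 \in I,
      [forall a : F, forall x in I, forall y in I, a *: x + y \in I]
    & [forall x : J, forall y in I, (x ** y \in I) && (y ** x \in I)]].

Definition orthogonal_complement (I : {set J}) :=
  [set lam : dual | [forall x in I, lam x == 0]].

(* The element x + I of J/I. *)
Definition jcoset (I : {set J}) x := [set x + y | y in I].

(* The orbit of x + I under u(x + I)v = uxv + I. *)
Definition UcosetU (I : {set J}) x :=
  [set jcoset I (uJ u (Ju x v)) | u : algebraGroup J, v : algebraGroup J].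

Definition jcoset_orbits (I : {set J}) := [set UcosetU I x | x : J].

End Dual.

Section Extension.

Variables (F : finFieldType) (L : finGroupType) (J : nilAlgebra F).
Variable E : algebraGroupExt L J.
Implicit Types (h k r p : L) (u v : algebraGroup J) (x y : J) (lam mu : dual J).

Definition Ad h x := ract E (lact E h x) h^-1.

Lemma Ad_linear h : linear (Ad h).
Proof. by move=> a x y; rewrite /Ad lact_linear (ract_linear E h^-1). Qed.

Lemma Ad1 x : Ad 1 x = x.
Proof. by rewrite /Ad lact1 invg1 ract1. Qed.

Lemma AdM h k x : Ad (h * k) x = Ad h (Ad k x).
Proof. by rewrite /Ad invMg lactM ractM -lact_ract. Qed.

Lemma Ad_mul h x y : Ad h (x ** y) = Ad h x ** Ad h y.
Proof.
by rewrite /Ad lact_jmul jmul_ract (lact_ract E h y) jmul_lact -ractM mulVg ract1.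
Qed.

Definition Ad_group h u := OnePlus (Ad h (minus_one u)).

(* The library's actions are on the right: h acts here by Ad_(h^-1). *)
Definition Ad_act u h := Ad_group h^-1 u.

Lemma Ad_act1 : Ad_act^~ 1%g =1 id.
Proof. by case=> x; rewrite /Ad_act /Ad_group invg1 Ad1. Qed.

Lemma Ad_actM u : act_morph Ad_act u.
Proof. by move=> h k; rewrite /Ad_act /Ad_group invMg AdM. Qed.

Canonical Ad_action := TotalAction Ad_act1 Ad_actM.

Lemma Ad_is_groupAction : is_groupAction [set: algebraGroup J] Ad_action.
Proof.
move=> h _; rewrite inE; apply/andP; split; first by apply/subsetP=> u; rewrite inE.
apply/morphicP=> u v _ _; rewrite !actpermE /= /Ad_act /Ad_group.
by congr (OnePlus _); rewrite /= !(linear_add (Ad_linear _)) Ad_mul.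
Qed.

Canonical Ad_groupAction := GroupAction Ad_is_groupAction.

Definition extGroup : finGroupType := sdprod_groupType Ad_groupAction.

Definition iL h : extGroup := sdpair2 Ad_groupAction h.
Definition iU u : extGroup := sdpair1 Ad_groupAction u.

(* The element h(1 + x) of G; [Lpart] and [Jpart] recover h and x. *)
Definition hx h x : extGroup := (iL h * iU (OnePlus x))%g.
Definition Lpart (g : extGroup) : L := (pair_of_sd g).1.
Definition Jpart (g : extGroup) : J := minus_one (pair_of_sd g).2.

(* (h lam)(x) = lam(x h) and (lam h)(x) = lam(h x). *)
Definition hD h lam := dual_comp lam (ract_linear E h).
Definition Dh lam h := dual_comp lam (lact_linear E h).

Definition Adstar h lam := Dh (hD h lam) h^-1.

Lemma AdstarE h lam x : Adstar h lam x = lam (ract E (lact E h^-1 x) h).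
Proof. by rewrite !dual_compE. Qed.

Definition Adstar_act lam h := Adstar h^-1 lam.

Lemma Adstar_act1 : Adstar_act^~ 1%g =1 id.
Proof. by move=> lam; apply: dual_eqP => x; rewrite AdstarE invgK invg1 ract1 lact1. Qed.

Lemma Adstar_actM lam : act_morph Adstar_act lam.
Proof.
move=> h k; apply: dual_eqP => x.
by rewrite !AdstarE !invgK invMg ractM lactM lact_ract.
Qed.

Definition Adstar_action := TotalAction Adstar_act1 Adstar_actM.

(* H_(U lam U) and S_(U lam U), as pointwise and setwise stabilisers. *)
Definition Hgroup lam : {group L} := 'C(UlamU lam | Adstar_action)%G.
Definition Sgroup lam : {group L} := 'N(UlamU lam | Adstar_action)%G.

Lemma UlamU_refl lam : lam \in UlamU lam.
Proof.
apply/imset2P; exists 1%g 1%g => //; apply: dual_eqP => x.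
by rewrite !dual_compE /uJ /Ju mul0j addr0 jmul0 addr0.
Qed.

Lemma Hgroup_Ad lam h x : h \in Hgroup lam -> lam (Ad h x) = lam x.
Proof.
move=> Hh; have /= {2}<- := astab_act Hh (UlamU_refl lam).
by rewrite AdstarE invgK.
Qed.

Lemma hxE h x : pair_of_sd (hx h x) = (h, OnePlus x).
Proof. by rewrite /hx /iL /iU /= !val_insubd /= !inE /= act1 mulg1 mul1g. Qed.

Lemma Lpart_hx h x : Lpart (hx h x) = h. Proof. by rewrite /Lpart hxE. Qed.
Lemma Jpart_hx h x : Jpart (hx h x) = x. Proof. by rewrite /Jpart hxE. Qed.

Lemma hx_parts g : hx (Lpart g) (Jpart g) = g.
Proof.
apply: val_inj; rewrite [LHS]hxE /Lpart /Jpart /=.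
by case: (pair_of_sd g) => h [x].
Qed.

Lemma hxM h x k y :
  (hx h x * hx k y)%g = hx (h * k) (Ad k^-1 x + y + Ad k^-1 x ** y).
Proof.
have e (g g' : extGroup) : pair_of_sd (g * g')%g = ((pair_of_sd g).1 *
  (pair_of_sd g').1, Ad_act (pair_of_sd g).2 (pair_of_sd g').1 *
  (pair_of_sd g').2)%g by [].
by apply/val_inj/(etrans (e _ _))/esym; rewrite !hxE; apply: hxE.
Qed.

(* H_0 |x U_(lam, right) as a subset, and then as a subgroup, of G. *)
Definition G0_set lam := [set hx h x | h in Hgroup lam, x in Jright lam].

Lemma mem_G0 lam h x :
  (hx h x \in G0_set lam) = (h \in Hgroup lam) && (x \in Jright lam).
Proof.
apply/imset2P/andP => [[k y Hk Jy e] | [Hh Jx]]; last by exists h x.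
move: (congr1 (@Lpart) e) (congr1 (@Jpart) e).
by rewrite !Lpart_hx !Jpart_hx => -> ->.
Qed.

Lemma Jright_Ad lam h x :
  h \in Hgroup lam -> x \in Jright lam -> Ad h x \in Jright lam.
Proof.
move=> Hh; rewrite !inE => /forallP Jx; apply/forallP=> z.
have -> : z = Ad h (Ad h^-1 z) by rewrite -AdM mulgV Ad1.
by rewrite -Ad_mul Hgroup_Ad.
Qed.

Lemma Jright0 lam : 0 \in Jright lam.
Proof. by rewrite inE; apply/forallP=> z; rewrite mul0j dual0. Qed.

Lemma G0_group_set lam : group_set (G0_set lam).
Proof.
apply/group_setP; split.
  have -> : 1%g = hx 1 0.
    by apply/val_inj/esym/(etrans (hxE _ _)).
  by rewrite mem_G0 group1 Jright0.
move=> _ _ /imset2P[h x Hh Jx ->] /imset2P[k y Hk Jy ->].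
rewrite hxM mem_G0 groupM //= inE; apply/forallP=> z.
have:= Jright_Ad (groupVr Hk) Jx; set x' := Ad _ _; rewrite inE => /forallP Jx'.
move: Jy; rewrite inE => /forallP Jy; rewrite !jmulDl -jmulA !dualD.
by rewrite (eqP (Jx' z)) (eqP (Jy z)) (eqP (Jx' _)) !addr0.
Qed.

Canonical G0_group lam := Group (G0_group_set lam).

Section Characters.

Variable eps : addChar F.

Definition xi_fun lam (theta : 'CF(Hgroup lam)) (g : extGroup) :=
  if g \in G0_set lam then theta (Lpart g) * eps (lam (Jpart g)) else 0.

Fact xi_subproof lam theta :
  is_class_fun <<G0_group lam>>%g (finfun (@xi_fun lam theta)).
Proof.
rewrite genGid; apply: intro_class_fun => [g k Gg Gk | g /negbTE nGg]; last first.
  by rewrite /xi_fun nGg.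
have etaM g1 g2 : g1 \in G0_set lam -> g2 \in G0_set lam ->
    eps (lam (Jpart (g1 * g2)%g)) = eps (lam (Jpart g1)) * eps (lam (Jpart g2)).
  move=> /imset2P[h x Hh Jx ->] /imset2P[h' y Hh' Jy ->].
  rewrite hxM !Jpart_hx !dualD Hgroup_Ad ?groupV //.
  have:= Jright_Ad (groupVr Hh') Jx; rewrite inE => /forallP/(_ y)/eqP->.
  by rewrite addr0 addcharD.
have LpartM g1 g2 : Lpart (g1 * g2)%g = (Lpart g1 * Lpart g2)%g by [].
have LpartV g1 : Lpart g1^-1%g = (Lpart g1)^-1%g by [].
have Lg := hx_parts g; have Lk := hx_parts k.
have Gkg: (g ^ k)%g \in G0_group lam by rewrite groupJ.
rewrite /xi_fun Gg Gkg; congr (_ * _).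
  rewrite /conjg !LpartM LpartV; apply: cfunJ.
  by move: Gk; rewrite /= -Lk mem_G0 Lpart_hx => /andP[].
rewrite /conjg !etaM ?groupM ?groupV // mulrC -mulrA -etaM ?groupV //.
have J1 : Jpart (1%g : extGroup) = 0 by [].
by rewrite mulgV J1 dual0 addchar0 mulr1.
Qed.

Definition xi lam theta : 'CF(G0_group lam) := Cfun 0 (@xi_subproof lam theta).

Lemma xiE lam theta h x : h \in Hgroup lam -> x \in Jright lam ->
  @xi lam theta (hx h x) = theta h * eps (lam x).
Proof.
by move=> Hh Jx; rewrite cfunElock /xi_fun mem_G0 Hh Jx Lpart_hx Jpart_hx.
Qed.

End Characters.

(* The pairs (theta, lam). An S-irreducible character theta of H_(U lam U) is
   encoded by the set of its irreducible constituents, an S-orbit of indices;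
   X is a set of representatives of the U x U orbits in J^*. *)
Definition A0_index := {lam : dual J & {set Iirr (Hgroup lam)}}.

Implicit Types a b : A0_index.

Definition A0 (X : {set dual J}) : {set A0_index} :=
  [set a | (tag a \in X) &&
           [exists i, tagged a == cfclass_Iirr (Sgroup (tag a)) i]].

Definition theta a : 'CF(Hgroup (tag a)) := \sum_(i in tagged a) 'chi_i.

(* b represents the image of a under r. Class functions vanish outside their
   group, so that the second condition is an equality of characters of
   r H r^-1. *)
Definition A0_conj r a b :=
  ([set Adstar r mu | mu in UlamU (tag a)] == UlamU (tag b)) &&
  [forall h, theta b h == theta a (r^-1 * h * r)%g].

Definition A_orbits X : {set {set A0_index}} :=
  [set [set b in A0 X | [exists r, A0_conj r a b]] | a in A0 X].

Definition chi (eps : addChar F) a : 'CF([set: extGroup]) :=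
  'Ind[[set: extGroup], G0_group (tag a)] (xi eps (theta a)).

(* J''_h; the least such ideal is the intersection of all of them. *)
Definition Jh h : {set J} :=
  \bigcap_(I : {set J} | is_ideal I &&
    [forall lam in orthogonal_complement I, Adstar h lam == lam]) I.

Definition B0_index := (L * {set {set J}})%type.

Definition B0 : {set B0_index} := [set b | b.2 \in jcoset_orbits (Jh b.1)].

Definition B0_conj r (b : B0_index) : B0_index :=
  ((r * b.1 * r^-1)%g, [set [set Ad r x | x in C] | C : {set J} in b.2]).

Definition B_orbits : {set {set B0_index}} :=
  [set [set B0_conj r b | r : L] | b in B0].

Definition superclass (b : B0_index) : {set extGroup} :=
  \bigcup_(p : L)
    [set iL p * hx b.1 x * (iL p)^-1 | x in [set x | jcoset (Jh b.1) x \in b.2]]%g.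

End Extension.

(* Main.v *)
Require Import Defs.
From HB Require Import structures.
From mathcomp Require Import all_boot all_order all_algebra.
From mathcomp Require Import all_fingroup all_solvable all_field all_character.
From mathcomp Require Import ring.

(** The proof is finite Fourier analysis on the additive group of J.

    Call a function f on G a superclass function if (h, x) |-> f(h(1 + x)) is
    invariant under conjugation by L, under x |-> uxv for u, v in U, and, for
    each h, under translation of x by J''_h. The superclasses are the fibres of
    the map sending h(1 + x) to the L-orbit of the pair of h and the U x U orbit
    of x + J''_h, so that they partition G ([superclass_fibre]) and superclass
    functions are the functions constant on them.

    Averaging over U first in the formula for the induced character gives
      chi(h(1 + x)) = c sum_(r in L) theta(r h r^-1) sum_(u, v in U) eps^(lam(v Ad_r(x) u))
    ([chi_formula]). It is a superclass function because h belongs to H_(U lam U)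
    exactly when lam vanishes on J''_h ([Hgroup_JhP]). For every superclass
    function f, all the averages in this formula can be moved onto f, hence
      sum_(g in G) chi(g) f(g) = c' sum_(h in L) sum_(x in J) theta(h) eps^(lam(x)) f(h(1 + x))
    with c' nonzero ([sum_chi_superclass_function]). This has two consequences.

    Orthogonality ([chi_orthogonal]): for f the conjugate of another chi, the
    sum over x kills everything unless the two U x U orbits in J^* are conjugate
    under L; when they are, the sum over h is the inner product of two
    S-irreducible characters of the same group, which vanishes unless these are
    equal.

    Completeness ([superclass_function_complete]): if f is orthogonal to all
    the characters, its Fourier transform in x vanishes at every (h, lam). If h
    is not in H_(U lam U), then lam is nonzero on J''_h, under which f is
    invariant. If it is, the transform is an S-invariant function of h in
    H_(U lam U), orthogonal to all S-irreducible characters. Hence f = 0.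

    Orthogonality and completeness say that the matrix of the sums of the
    characters over the superclasses has independent rows and independent
    columns. It is therefore square, and there are as many characters as
    superclasses ([card_A_orbits]). *)

Set Implicit Arguments.
Unset Strict Implicit.
Unset Printing Implicit Defensive.

Import Order.TTheory GRing.Theory Num.Theory.
Local Open Scope ring_scope.

Local Notation "x ** y" := (jmul x y) (at level 40, left associativity).

(** * Fourier analysis on J *)
Section Fourier.

Variables (F : finFieldType) (J : nilAlgebra F) (eps : addChar F).
Implicit Types (x y z : J) (mu nu : dual J) (I : {set J}).

Lemma dualZ mu a x : mu (a *: x) = a * mu x.
Proof. by rewrite -[_ *: _]addr0 dual_linear dual0 addr0. Qed.

Lemma dualB mu x y : mu (x - y) = mu x - mu y.
Proof. by rewrite dualD -scaleN1r dualZ mulN1r. Qed.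

Fact dual_lincomb_subproof a mu nu : is_functional [ffun x => a * mu x + nu x].
Proof.
apply/forallP=> b; apply/forallP=> x; apply/forallP=> y; rewrite !ffunE.
rewrite !dual_linear; apply/eqP; ring.
Qed.

Definition dual_lincomb a mu nu := Dual (dual_lincomb_subproof a mu nu).

Lemma dual_lincombE a mu nu x : dual_lincomb a mu nu x = a * mu x + nu x.
Proof. by rewrite {1}/dual_fun ffunE. Qed.

Fact dual_zero_subproof : is_functional [ffun _ : J => 0 : F].
Proof.
apply/forallP=> b; apply/forallP=> x; apply/forallP=> y.
by rewrite !ffunE mulr0 addr0.
Qed.

Definition dual_zero := Dual dual_zero_subproof.

(** The values of eps are roots of unity, since F has positive characteristic. *)
Lemma eps_conj t : (eps t)^* = eps (- t).
Proof.
have epsN s : eps s * eps (- s) = 1 by rewrite -addcharD subrr addchar0.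
have epsX s n : eps (s *+ n) = eps s ^+ n.
  by elim: n => [|n IHn]; rewrite ?addchar0 // mulrS addcharD IHn exprS.
have [p p_pr charFp] := finPcharP F.
have: `|eps t| ^+ p = 1 by rewrite -normrX -epsX mulrn_pchar // addchar0 normr1.
move/eqP; rewrite pexpr_eq1 ?prime_gt0 // => /eqP n1.
have e0 : eps t != 0 by rewrite -normr_eq0 n1 oner_eq0.
by apply: (mulfI e0); rewrite epsN -normCK n1 expr1n.
Qed.

Lemma exists_scalar_eps_neq1 c : c != 0 -> exists a, eps (a * c) != 1.
Proof.
move=> c0; have [t /eqP nt] := addchar_nontrivial eps.
by exists (t / c); rewrite divfK.
Qed.

(** If mu is nonzero, some translation of J multiplies the sum by a value of eps
    different from 1. *)
Lemma sum_eps_dual mu :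
  \sum_x eps (mu x) = if [forall x, mu x == 0] then #|J|%:R else 0.
Proof.
case: ifP => [/forallP mu0 | /negbT].
  under eq_bigr => x _ do rewrite (eqP (mu0 x)) addchar0.
  by rewrite sumr_const.
rewrite negb_forall => /existsP[x0 /exists_scalar_eps_neq1[a na]].
set S := \sum_x _; have: S = eps (mu (a *: x0)) * S.
  rewrite {1}/S (reindex_inj (addrI (a *: x0))) mulr_sumr.
  by apply: eq_bigr => x _; rewrite dualD addcharD.
rewrite dualZ => /eqP; rewrite -subr_eq0 -{1}[S]mul1r -mulrBl mulf_eq0.
by rewrite subr_eq0 eq_sym (negbTE na) => /eqP.
Qed.

Definition is_subspace I :=
  (0 \in I) && [forall a : F, forall x in I, forall y in I, a *: x + y \in I].

Lemma is_subspaceP I :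
  reflect (0 \in I /\ forall a x y, x \in I -> y \in I -> a *: x + y \in I)
          (is_subspace I).
Proof.
apply: (iffP andP) => -[I0 IL]; split=> //.
  by move=> a x y Ix; move: y; apply/forall_inP; move: x Ix; apply/forall_inP;
     apply: (forallP IL).
by apply/forallP=> a; apply/forall_inP=> x Ix; apply/forall_inP=> y; apply: IL.
Qed.

(** Among the subspaces containing I but not y, a maximal one M satisfies
    J = M + F y, since enlarging M by any further vector puts y in it. The
    functional is the coordinate along y modulo M. *)
Lemma subspace_separation I y : is_subspace I -> y \notin I ->
  exists2 mu : dual J, {in I, forall x : J, mu x = 0} & mu y != 0.
Proof.
move=> subI Iy; pose P (M : {set J}) := is_subspace M && (y \notin M).
have [|M] := @maxset_exists _ P I; first by rewrite /P subI.
case/maxsetP=> /andP[/is_subspaceP[M0 ML] My] maxM sIM.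
have MZ a x : x \in M -> a *: x \in M by move=> Mx; rewrite -[_ *: _]addr0 ML.
have MD x z : x \in M -> z \in M -> x + z \in M.
  by move=> Mx Mz; rewrite -[x]scale1r ML.
have MB x z : x \in M -> z \in M -> x - z \in M.
  by move=> Mx Mz; rewrite MD // -(scaleN1r z) MZ.
have ex x : exists c, x - c *: y \in M.
  have [Mx | Mx] := boolP (x \in M); first by exists 0; rewrite scale0r subr0.
  pose M' := [set z | [exists a : F, z - a *: x \in M]].
  have sMM' : M \subset M'.
    apply/subsetP=> z Mz; rewrite inE; apply/existsP; exists 0.
    by rewrite scale0r subr0.
  have M'x : x \in M'.
    by rewrite inE; apply/existsP; exists 1; rewrite scale1r subrr.
  have subM' : is_subspace M'.
    apply/is_subspaceP; split; first exact: (subsetP sMM').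
    move=> a z w; rewrite !inE => /existsP[b Mb] /existsP[c Mc].
    apply/existsP; exists (a * b + c).
    rewrite scalerDl -scalerA opprD addrACA -scalerBr; exact: ML.
  have M'y : y \in M'.
    apply: contraR Mx => M'y; rewrite -(maxM M') //.
    by rewrite /P subM'.
  move: M'y; rewrite inE => /existsP[a Ma].
  have a0 : a != 0 by apply: contraNneq My => a0; rewrite a0 scale0r subr0 in Ma.
  exists a^-1; rewrite -[x](scalerK a0) -scalerBr MZ //.
  by rewrite -opprB -(scaleN1r (y - a *: x)) MZ.
pose f x := xchoose (ex x); have fP x : x - f x *: y \in M := xchooseP (ex x).
have f_uniq x c : x - c *: y \in M -> f x = c.
  move=> Mc; apply: contraNeq My; rewrite -subr_eq0 => nc.
  rewrite -(scalerK nc y) MZ // scalerBl.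
  have -> : f x *: y - c *: y = (x - c *: y) - (x - f x *: y).
    by rewrite opprB [RHS]addrC subrKA.
  exact: MB.
have fL : is_functional (finfun f).
  apply/forallP=> a; apply/forallP=> x; apply/forallP=> z; rewrite !ffunE.
  apply/eqP/f_uniq; rewrite scalerDl -scalerA opprD addrACA -scalerBr.
  exact: ML.
exists (Dual fL) => [x Ix|]; rewrite /dual_fun /= ffunE.
  by apply: f_uniq; rewrite scale0r subr0 (subsetP sIM).
by rewrite (@f_uniq y 1) ?oner_eq0 // scale1r subrr.
Qed.

(** Same translation argument, now in J^*, by a functional that is nonzero at z. *)
Lemma sum_dual_eps z :
  \sum_(mu : dual J) eps (mu z) = if z == 0 then #|{: dual J}|%:R else 0.
Proof.
case: eqP => [-> | /eqP z0].
  under eq_bigr => mu _ do rewrite dual0 addchar0.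
  by rewrite sumr_const.
have [||mu0 _] := @subspace_separation [set 0] z; last 1 first.
- case/exists_scalar_eps_neq1=> a na; set S := \sum_(mu : dual J) _.
  have shift_inj : injective (dual_lincomb a mu0).
    move=> mu nu e; apply: dual_eqP => x; apply: (addrI (a * mu0 x)).
    by rewrite -!dual_lincombE e.
  have: S = eps (a * mu0 z) * S.
    rewrite {1}/S (reindex_inj shift_inj) mulr_sumr.
    by apply: eq_bigr => mu _; rewrite dual_lincombE addcharD.
  move=> /eqP; rewrite -subr_eq0 -{1}[S]mul1r -mulrBl mulf_eq0.
  by rewrite subr_eq0 eq_sym (negbTE na) => /eqP.
- apply/is_subspaceP; split=> [|a x y]; rewrite !inE // => /eqP-> /eqP->.
  by rewrite scaler0 addr0.
by rewrite inE.
Qed.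

Lemma fourier_inj (f : J -> algC) :
  (forall mu, \sum_x f x * eps (mu x) = 0) -> forall y, f y = 0.
Proof.
move=> f0 y; have: \sum_(mu : dual J) (\sum_x f x * eps (mu x)) * eps (- mu y) = 0.
  by rewrite big1 // => mu _; rewrite f0 mul0r.
under eq_bigr => mu _ do rewrite mulr_suml.
rewrite exchange_big (bigD1 y) //= [X in _ + X]big1 ?addr0 => [|x xy]; last first.
  under eq_bigr => mu _ do rewrite -mulrA -addcharD -dualB.
  by rewrite -mulr_sumr sum_dual_eps subr_eq0 (negbTE xy) mulr0.
under eq_bigr => mu _ do rewrite -mulrA -addcharD subrr addchar0 mulr1.
rewrite sumr_const => /eqP; rewrite mulrn_eq0 => /orP[|/eqP//].
by rewrite (cardD1 dual_zero).
Qed.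

End Fourier.

(** * The two actions of U and the two-sided orbits *)
Section TwoSidedOrbits.

Variables (F : finFieldType) (J : nilAlgebra F).
Implicit Types (x y z : J) (u v : algebraGroup J) (lam mu : dual J) (I : {set J}).

Lemma uJ1 x : uJ 1%g x = x.
Proof. by rewrite /uJ mul0j addr0. Qed.

Lemma Ju1 x : Ju x 1%g = x.
Proof. by rewrite /Ju jmul0 addr0. Qed.

Lemma uJM u v x : uJ (u * v)%g x = uJ u (uJ v x).
Proof.
rewrite /uJ /= !(jmulDl, jmulDr) jmulA -!addrA; congr (_ + _).
by rewrite addrCA.
Qed.

Lemma JuM x u v : Ju x (u * v)%g = Ju (Ju x u) v.
Proof. by rewrite /Ju /= !(jmulDl, jmulDr) jmulA -!addrA. Qed.

Lemma uJ_Ju u x v : uJ u (Ju x v) = Ju (uJ u x) v.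
Proof.
rewrite /uJ /Ju /= !(jmulDl, jmulDr) jmulA -!addrA; congr (_ + _).
by rewrite addrCA.
Qed.

Lemma uJD u x y : uJ u (x + y) = uJ u x + uJ u y.
Proof. exact: (linear_add (uJ_linear u)). Qed.

Lemma JuD x y u : Ju (x + y) u = Ju x u + Ju y u.
Proof. exact: (linear_add (Ju_linear u)). Qed.

Lemma mem_UlamU lam mu :
  reflect (exists u v, forall x, mu x = lam (uJ v (Ju x u))) (mu \in UlamU lam).
Proof.
apply: (iffP imset2P) => [[u v _ _ ->] | [u [v muE]]].
  by exists u; exists v => x; rewrite !dual_compE uJ_Ju.
by exists u v => //; apply: dual_eqP => x; rewrite muE !dual_compE uJ_Ju.
Qed.

Lemma UlamU_eq lam mu : mu \in UlamU lam -> UlamU mu = UlamU lam.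
Proof.
case/mem_UlamU=> u [v muE]; apply/setP=> nu; apply/mem_UlamU/mem_UlamU.
  case=> u' [v' nuE]; exists (u' * u)%g; exists (v * v')%g => x.
  by rewrite nuE muE JuM uJM -uJ_Ju.
case=> u' [v' nuE]; exists (u' * u^-1)%g; exists (v^-1 * v')%g => x.
by rewrite muE nuE -uJ_Ju -uJM mulKVg -JuM mulgKV.
Qed.

Lemma is_idealP I :
  reflect [/\ is_subspace I,
              forall x y, y \in I -> x ** y \in I
            & forall x y, y \in I -> y ** x \in I] (is_ideal I).
Proof.
apply: (iffP and3P) => [[I0 IL IM] | [/andP[I0 IL] Il Ir]].
  split=> [|x y Iy|x y Iy]; first exact/andP.
    by have/forallP/(_ x)/forall_inP/(_ y Iy)/andP[] := IM.
  by have/forallP/(_ x)/forall_inP/(_ y Iy)/andP[] := IM.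
split=> //; apply/forallP=> x; apply/forall_inP=> y Iy.
by rewrite Il ?Ir.
Qed.

Lemma ideal0 I : is_ideal I -> 0 \in I.
Proof. by case/is_idealP=> /is_subspaceP[]. Qed.

Lemma idealD I x y : is_ideal I -> x \in I -> y \in I -> x + y \in I.
Proof. by case/is_idealP=> /is_subspaceP[_ /(_ 1)]; rewrite -{2}[x]scale1r; auto. Qed.

Lemma idealN I x : is_ideal I -> x \in I -> - x \in I.
Proof.
move=> idI Ix; rewrite -scaleN1r -[_ *: _]addr0.
by have [/is_subspaceP[I0 IL] _ _] := is_idealP _ idI; apply: IL.
Qed.

Lemma ideal_uJ I u x : is_ideal I -> x \in I -> uJ u x \in I.
Proof. by move=> idI Ix; apply: idealD => //; have [_ ->] := is_idealP _ idI. Qed.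

Lemma ideal_Ju I u x : is_ideal I -> x \in I -> Ju x u \in I.
Proof. by move=> idI Ix; apply: idealD => //; have [_ _ ->] := is_idealP _ idI. Qed.

(** The largest ideal on which lam vanishes. *)
Definition orbit_kernel lam : {set J} :=
  [set x | [forall mu in UlamU lam, mu x == 0]].

Lemma orbit_kernelP lam x :
  reflect (forall u v, lam (uJ v (Ju x u)) = 0) (x \in orbit_kernel lam).
Proof.
rewrite inE; apply: (iffP forall_inP) => [ker_x u v | ker_x mu].
  have /ker_x/eqP : Du (uD u lam) v \in UlamU lam by apply/imset2P; exists u v.
  by rewrite !dual_compE uJ_Ju.
by case/mem_UlamU=> u [v ->]; rewrite ker_x.
Qed.

(** Stability under multiplication by z comes from stability under the action of
    U, because z x = (1 + z) x - x. *)
Lemma orbit_kernel_ideal lam : is_ideal (orbit_kernel lam).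
Proof.
have uJ_sub z y : z ** y = uJ (OnePlus z) y - y.
  by rewrite /uJ addrC addKr.
have Ju_sub z y : y ** z = Ju y (OnePlus z) - y.
  by rewrite /Ju addrC addKr.
have ker_subspace : is_subspace (orbit_kernel lam).
  apply/is_subspaceP; split=> [|a x y /orbit_kernelP kx /orbit_kernelP ky].
    by rewrite inE; apply/forall_inP=> mu _; rewrite dual0.
  apply/orbit_kernelP=> u v.
  by rewrite Ju_linear uJ_linear dual_linear kx ky mulr0 addr0.
have kerB x y : x \in orbit_kernel lam -> y \in orbit_kernel lam ->
    x - y \in orbit_kernel lam.
  have /is_subspaceP[_ kL] := ker_subspace.
  by move=> kx ky; rewrite addrC -(scaleN1r y) kL.
apply/is_idealP; split=> // z x kx.
  rewrite uJ_sub kerB //; apply/orbit_kernelP=> u v.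
  by rewrite -uJ_Ju -uJM; apply/orbit_kernelP.
rewrite Ju_sub kerB //; apply/orbit_kernelP=> u v.
by rewrite -JuM; apply/orbit_kernelP.
Qed.

Lemma sub_orbit_kernel I lam : is_ideal I -> {in I, forall x : J, lam x = 0} ->
  I \subset orbit_kernel lam.
Proof.
move=> idI lam0; apply/subsetP=> x Ix; apply/orbit_kernelP=> u v.
by rewrite lam0 // ideal_uJ // ideal_Ju.
Qed.

End TwoSidedOrbits.

(** * Conjugation by L, and the ideals J''_h *)
Section Conjugation.

Variables (F : finFieldType) (L : finGroupType) (J : nilAlgebra F).
Variable E : algebraGroupExt L J.
Implicit Types (h k r p : L) (x y z : J) (u v : algebraGroup J) (lam mu : dual J).

Local Notation Ad := (Ad E).

Lemma AdK h : cancel (Ad h) (Ad h^-1%g).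
Proof. by move=> x; rewrite -AdM mulVg Ad1. Qed.

Lemma AdKV h : cancel (Ad h^-1%g) (Ad h).
Proof. by move=> x; rewrite -AdM mulgV Ad1. Qed.

Lemma Ad_inj h : injective (Ad h).
Proof. exact: can_inj (AdK h). Qed.

Lemma AdD h x y : Ad h (x + y) = Ad h x + Ad h y.
Proof. exact: (linear_add (Ad_linear E h)). Qed.

Lemma AdN h x : Ad h (- x) = - Ad h x.
Proof.
by apply: (addrI (Ad h x)); rewrite -AdD !subrr; apply: (linear_0 (Ad_linear E h)).
Qed.

Lemma Ad_uJ h u x : Ad h (uJ u x) = uJ (Ad_group E h u) (Ad h x).
Proof. by rewrite /uJ AdD Ad_mul. Qed.

Lemma Ad_Ju h x u : Ad h (Ju x u) = Ju (Ad h x) (Ad_group E h u).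
Proof. by rewrite /Ju AdD Ad_mul. Qed.

Lemma Ad_groupK h : cancel (Ad_group E h) (Ad_group E h^-1%g).
Proof. by case=> x; rewrite /Ad_group /= AdK. Qed.

Lemma Ad_groupKV h : cancel (Ad_group E h^-1%g) (Ad_group E h).
Proof. by case=> x; rewrite /Ad_group /= AdKV. Qed.

Lemma Adstar_Ad h lam x : Adstar E h lam x = lam (Ad h^-1%g x).
Proof. by rewrite AdstarE /Ad invgK. Qed.

Lemma AdstarM h k lam : Adstar E (h * k)%g lam = Adstar E h (Adstar E k lam).
Proof. by apply: dual_eqP => x; rewrite !Adstar_Ad invMg AdM. Qed.

Lemma Adstar1 lam : Adstar E 1%g lam = lam.
Proof. by apply: dual_eqP => x; rewrite Adstar_Ad invg1 Ad1. Qed.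

Lemma AdstarK h : cancel (Adstar E h) (Adstar E h^-1%g).
Proof. by move=> lam; rewrite -AdstarM mulVg Adstar1. Qed.

Lemma Adstar_UlamU h lam : [set Adstar E h mu | mu in UlamU lam] = UlamU (Adstar E h lam).
Proof.
apply/setP=> nu; apply/imsetP/mem_UlamU => [[mu /mem_UlamU[u [v muE]] ->] | [u [v nuE]]].
  exists (Ad_group E h u); exists (Ad_group E h v) => x.
  by rewrite !Adstar_Ad muE Ad_uJ Ad_Ju !Ad_groupK.
exists (Adstar E h^-1 nu).
  apply/mem_UlamU; exists (Ad_group E h^-1 u); exists (Ad_group E h^-1 v) => x.
  by rewrite Adstar_Ad nuE Adstar_Ad Ad_uJ Ad_Ju invgK AdK.
by rewrite -{1}[h]invgK AdstarK.
Qed.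

Lemma HgroupP lam h :
  reflect {in UlamU lam, forall mu : dual J, forall x, mu (Ad h x) = mu x}
          (h \in Hgroup E lam).
Proof.
apply: (iffP idP) => [Hh mu mu_lam x | fix_h].
  by rewrite Hgroup_Ad //; move: Hh; rewrite /= (UlamU_eq mu_lam).
apply/astabP=> mu mu_lam; apply: dual_eqP => x.
by rewrite /= /Adstar_act Adstar_Ad invgK fix_h.
Qed.

Lemma Hgroup_eq lam mu : mu \in UlamU lam -> Hgroup E mu = Hgroup E lam.
Proof. by move=> mu_lam; apply/val_inj; rewrite /= (UlamU_eq mu_lam). Qed.

Lemma SgroupP lam r :
  reflect (Adstar E r^-1 lam \in UlamU lam) (r \in Sgroup E lam).
Proof.
rewrite !inE /=; apply: (iffP subsetP) => [Sr | Sr mu mu_lam].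
  by have := Sr _ (UlamU_refl lam); rewrite inE.
by rewrite inE /= /Adstar_act -(UlamU_eq Sr) -Adstar_UlamU imset_f.
Qed.

Lemma Hgroup_conj r lam h :
  (r * h * r^-1 \in Hgroup E (Adstar E r lam))%g = (h \in Hgroup E lam).
Proof.
have sub_conj r' h' lam' : h' \in Hgroup E lam' ->
    (r' * h' * r'^-1 \in Hgroup E (Adstar E r' lam'))%g.
  move=> /HgroupP Hh; apply/HgroupP=> mu; rewrite -Adstar_UlamU.
  case/imsetP=> nu nu_lam -> x.
  by rewrite !Adstar_Ad -AdM -!mulgA mulKg AdM Hh // .
apply/idP/idP => [/(sub_conj r^-1%g)|]; last exact: sub_conj.
by rewrite AdstarK invgK !mulgA mulVg mul1g mulgKV.
Qed.

Lemma Sgroup_conj r lam s :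
  (r * s * r^-1 \in Sgroup E (Adstar E r lam))%g = (s \in Sgroup E lam).
Proof.
have sub_conj r' s' lam' : s' \in Sgroup E lam' ->
    (r' * s' * r'^-1 \in Sgroup E (Adstar E r' lam'))%g.
  move=> /SgroupP Ss; apply/SgroupP; rewrite -Adstar_UlamU.
  apply/imsetP; exists (Adstar E s'^-1 lam') => //.
  by rewrite -!AdstarM !invMg invgK !mulgA mulgKV.
apply/idP/idP => [/(sub_conj r^-1%g)|]; last exact: sub_conj.
by rewrite AdstarK invgK !mulgA mulVg mul1g mulgKV.
Qed.

Definition fixes_mod h (I : {set J}) := forall x, Ad h x - x \in I.

(** The condition in J/I is dual to the one on the orthogonal complement of I:
    a vector outside I is detected by a functional vanishing on I. *)
Lemma fixes_modP h (I : {set J}) : is_ideal I ->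
  reflect (fixes_mod h I)
    [forall lam in orthogonal_complement I, Adstar E h lam == lam].
Proof.
move=> idI; apply: (iffP forall_inP) => [fixI x | modI lam].
  apply: contraT => Ix; have [subI _ _] := is_idealP _ idI.
  have [mu mu0] := subspace_separation subI Ix.
  have /fixI/eqP <-: mu \in orthogonal_complement I.
    by rewrite inE; apply/forall_inP=> y /mu0->.
  rewrite dualB !Adstar_Ad AdK.
  have /fixI/eqP/(congr1 (fun nu : dual J => nu x)) : mu \in orthogonal_complement I.
    by rewrite inE; apply/forall_inP=> y /mu0->.
  by rewrite Adstar_Ad => ->; rewrite subrr eqxx.
rewrite inE => /forall_inP lam0; apply/eqP/dual_eqP => x.
rewrite Adstar_Ad -[in RHS](AdKV h x); apply/eqP.
by rewrite eq_sym -subr_eq0 -dualB lam0.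
Qed.

Lemma Jh_ideal h : is_ideal (Jh E h).
Proof.
apply/is_idealP; split; first (apply/is_subspaceP; split).
- by apply/bigcapP=> I /andP[/ideal0].
- move=> a x y /bigcapP Jx /bigcapP Jy; apply/bigcapP=> I PI.
  case/andP: (PI) => /is_idealP[/is_subspaceP[_ IL] _ _] _.
  by rewrite IL ?Jx ?Jy.
- move=> x y /bigcapP Jy; apply/bigcapP=> I PI.
  by case/andP: (PI) => /is_idealP[_ Il _] _; exact: Il (Jy I PI).
move=> x y /bigcapP Jy; apply/bigcapP=> I PI.
by case/andP: (PI) => /is_idealP[_ _ Ir] _; exact: Ir (Jy I PI).
Qed.

(** With the next lemma, J''_h is the ideal generated by the Ad_h(x) - x. *)
Lemma Jh_fixes h : fixes_mod h (Jh E h).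
Proof. by move=> x; apply/bigcapP=> I /andP[idI /(fixes_modP h idI)]. Qed.

Lemma Jh_min h (I : {set J}) : is_ideal I -> fixes_mod h I -> Jh E h \subset I.
Proof.
by move=> idI modI; apply: (bigcap_inf I); rewrite idI /=; exact/(fixes_modP h idI).
Qed.

Lemma Jh_Ad p h x : x \in Jh E h -> Ad p x \in Jh E (p * h * p^-1)%g.
Proof.
set J' := Jh E (p * h * p^-1)%g; pose I := [set y | Ad p y \in J'].
have idJ' : is_ideal J' := Jh_ideal _.
have [/is_subspaceP[J0 JL] Jl Jr] := is_idealP _ idJ'.
suff sJI : Jh E h \subset I by move/(subsetP sJI); rewrite inE.
apply: Jh_min => [|y].
  apply/is_idealP; split; first (apply/is_subspaceP; split).
  - by rewrite inE (linear_0 (Ad_linear E p)).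
  - by move=> a y z; rewrite !inE Ad_linear; apply: JL.
  - by move=> y z; rewrite !inE Ad_mul; apply: Jl.
  by move=> y z; rewrite !inE Ad_mul; apply: Jr.
rewrite inE AdD AdN.
have := Jh_fixes (p * h * p^-1)%g (Ad p y).
by rewrite -AdM mulgKV AdM.
Qed.

Lemma Jh1 : Jh E 1%g = [set 0].
Proof.
apply/eqP; rewrite eqEsubset sub1set ideal0 ?Jh_ideal // andbT.
apply: Jh_min => [|x]; last by rewrite Ad1 subrr inE.
apply/is_idealP; split; first (apply/is_subspaceP; split).
- by rewrite inE.
- by move=> a x y; rewrite !inE => /eqP-> /eqP->; rewrite scaler0 addr0.
- by move=> x y; rewrite !inE => /eqP->; rewrite jmul0.
by move=> x y; rewrite !inE => /eqP->; rewrite mul0j.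
Qed.

(** The link between characters and classes. Both conditions say that the
    ideal [orbit_kernel lam] contains all the Ad_h(x) - x. *)
Lemma Hgroup_JhP lam h :
  reflect {in Jh E h, forall x : J, lam x = 0} (h \in Hgroup E lam).
Proof.
apply: (iffP (HgroupP _ _)) => [fix_h x | lam0 mu mu_lam x].
  suff sJk: Jh E h \subset orbit_kernel lam.
    move/(subsetP sJk); rewrite inE => /forall_inP/(_ _ (UlamU_refl lam)).
    by move/eqP.
  apply: Jh_min (orbit_kernel_ideal lam) _ => y.
  by rewrite inE; apply/forall_inP=> mu /fix_h mu_h; rewrite dualB mu_h subrr.
have /subsetP/(_ _ (Jh_fixes h x)) := sub_orbit_kernel (Jh_ideal h) lam0.
rewrite inE => /forall_inP/(_ _ mu_lam).
by rewrite dualB subr_eq0 => /eqP.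
Qed.

End Conjugation.

(** * The values of the induced characters *)
Section Elements.

Variables (F : finFieldType) (L : finGroupType) (J : nilAlgebra F).
Variable E : algebraGroupExt L J.
Implicit Types (h k r p : L) (x y z : J) (u v : algebraGroup J) (lam mu : dual J).
Implicit Types (a b : A0_index E).

Lemma iL_hx p : iL E p = hx E p 0.
Proof. by rewrite /hx [iU _ _]morph1 mulg1. Qed.

Lemma iU_hx u : iU E u = hx E 1 (minus_one u).
Proof. by case: u => x; rewrite /hx [iL _ _]morph1 mul1g. Qed.

Lemma iUV u : ((iU E u)^-1 = iU E u^-1)%g.
Proof. by rewrite /iU morphV ?inE. Qed.

Lemma iLV p : ((iL E p)^-1 = iL E p^-1)%g.
Proof. by rewrite /iL morphV ?inE. Qed.

Lemma hx_conjL p h x :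
  (iL E p * hx E h x * (iL E p)^-1 = hx E (p * h * p^-1) (Ad E p x))%g.
Proof.
apply: (canLR (mulgK _)); rewrite iL_hx !hxM mulgKV AdK.
by rewrite (linear_0 (Ad_linear E _)) mul0j jmul0 add0r !addr0.
Qed.

Lemma hx_conjU v h x : (iU E v * hx E h x * (iU E v)^-1 =
  hx E h (minus_one (Ad_group E h^-1 v * OnePlus x * v^-1)%g))%g.
Proof.
rewrite iUV !iU_hx !hxM mul1g mulg1 invg1 Ad1.
by congr (hx E h _); rewrite -[RHS]/(minus_one _).
Qed.

Lemma sum_hx (R : nmodType) (f : extGroup E -> R) :
  \sum_g f g = \sum_h \sum_x f (hx E h x).
Proof.
rewrite pair_big /= (reindex (fun hx0 : L * J => hx E hx0.1 hx0.2)) //=.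
exists (fun g => (Lpart g, Jpart g)) => [[h x] _ | g _] /=.
  by rewrite Lpart_hx Jpart_hx.
exact: hx_parts.
Qed.

Lemma sum_algebraGroup (R : nmodType) (f : algebraGroup J -> R) :
  \sum_u f u = \sum_x f (OnePlus x).
Proof.
rewrite (reindex (@OnePlus F J)) //.
by exists (@minus_one F J) => [x | [x]].
Qed.

Lemma card_algebraGroup : #|{: algebraGroup J}| = #|J|.
Proof.
apply/esym/(bij_eq_card (f := @OnePlus F J)).
by exists (@minus_one F J) => [x | [x]].
Qed.

End Elements.

Section CharacterFormula.

Variables (F : finFieldType) (L : finGroupType) (J : nilAlgebra F).
Variables (E : algebraGroupExt L J) (eps : addChar F).
Implicit Types (h k r p : L) (x y z : J) (u v : algebraGroup J) (lam mu : dual J).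
Implicit Types (a b : A0_index E).

Lemma JrightP mu x : reflect (forall z, mu (x ** z) = 0) (x \in Jright mu).
Proof.
by rewrite inE; apply: (iffP forallP) => mu0 z; [apply/eqP | rewrite mu0].
Qed.

Lemma sum_eps_Ju mu x :
  \sum_u eps (mu (Ju x u)) = (#|J|%:R * eps (mu x)) *+ (x \in Jright mu).
Proof.
rewrite sum_algebraGroup.
under eq_bigr => z _ do rewrite /Ju dualD addcharD /=.
rewrite -mulr_sumr mulrC -mulrnAl; congr (_ * _).
under eq_bigr => z _ do rewrite -(dual_compE mu (jmul_linear_r x)).
rewrite sum_eps_dual inE mulrb; congr (if _ then _ else _).
by apply: eq_forallb => z; rewrite dual_compE.
Qed.

(** Up to a factor, the sum of eps^(mu(x)) over mu in U lam U. *)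
Definition orbit_sum lam x := \sum_v \sum_u eps (lam (uJ v (Ju x u))).

Lemma orbit_sum_uJ lam u x : orbit_sum lam (uJ u x) = orbit_sum lam x.
Proof.
rewrite /orbit_sum [RHS](reindex_inj (mulIg u)) /=.
by apply: eq_bigr => v _; apply: eq_bigr => w _; rewrite -uJ_Ju uJM.
Qed.

Lemma orbit_sum_Ju lam x u : orbit_sum lam (Ju x u) = orbit_sum lam x.
Proof.
apply: eq_bigr => v _; rewrite [RHS](reindex_inj (mulgI u)) /=.
by apply: eq_bigr => w _; rewrite JuM.
Qed.

Lemma orbit_sum_shift lam h x y : h \in Hgroup E lam -> y \in Jh E h ->
  orbit_sum lam (x + y) = orbit_sum lam x.
Proof.
move=> /Hgroup_JhP lam0 Jy; apply: eq_bigr => v _; apply: eq_bigr => u _.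
have /subsetP/(_ y Jy)/orbit_kernelP ker_y := sub_orbit_kernel (Jh_ideal E h) lam0.
by rewrite JuD uJD dualD ker_y addr0.
Qed.

Lemma xi_formula lam (phi : 'CF(Hgroup E lam)) h x :
  xi eps phi (hx E h x) = (phi h * eps (lam x)) *+ (x \in Jright lam).
Proof.
have [Jx | nJx] := boolP (x \in _); rewrite ?mulr1n ?mulr0n; last first.
  by rewrite cfun0 //= mem_G0 (negbTE nJx) andbF.
have [Hh | nHh] := boolP (h \in Hgroup E lam); first by rewrite xiE.
by rewrite (cfun0 phi nHh) mul0r cfun0 //= mem_G0 (negbTE nHh).
Qed.

(** For h in H_(U lam U), the conjugate of h(1 + x) by v is h(1 + w), where
    (1 + w) v = v' (1 + x), v' = h^-1 v h, and lam(v' z) = lam(v z) for all z.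
    Comparing the values of lam shows that w lies in J_(lam, right) if and only
    if x lies in J_(lam v, right), and that then lam(w) = lam(v x). By
    [sum_eps_Ju] the sum over u in [orbit_sum] encodes this condition on x. *)
Lemma xi_conjU_sum lam (phi : 'CF(Hgroup E lam)) h x :
  \sum_u xi eps phi (iU E u * hx E h x * (iU E u)^-1)%g =
    #|J|%:R^-1 * (phi h * orbit_sum lam x).
Proof.
have J0 : #|J|%:R != 0 :> algC by rewrite pnatr_eq0 (cardD1 0).
rewrite /orbit_sum !mulr_sumr; apply: eq_bigr => v _.
under [in RHS]eq_bigr => u _ do rewrite -(dual_compE lam (uJ_linear v)).
rewrite sum_eps_Ju hx_conjU xi_formula.
have [Hh | nHh] := boolP (h \in Hgroup E lam); last first.
  by rewrite (cfun0 _ nHh) !mul0r mulr0 mul0rn.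
set w := minus_one _.
have lam_v' z : lam (uJ (Ad_group E h^-1 v) z) = lam (uJ v z).
  rewrite -(Hgroup_Ad _ Hh) Ad_uJ Ad_groupKV -[LHS](dual_compE lam (uJ_linear v)).
  rewrite -[RHS](dual_compE lam (uJ_linear v)); apply: (HgroupP E lam h Hh).
  by apply/mem_UlamU; exists 1%g; exists v => y; rewrite dual_compE Ju1.
have w_eq : (OnePlus w * v)%g = (Ad_group E h^-1 v * OnePlus x)%g.
  have -> : OnePlus w = (Ad_group E h^-1 v * OnePlus x * v^-1)%g.
    by rewrite /w; case: (_ * _)%g.
  by rewrite mulgKV.
clearbody w.
have lam_w z : lam (w ** uJ v z) = lam (uJ v (x ** z)).
  have: lam (uJ (OnePlus w) (uJ v z)) = lam (uJ v (uJ (OnePlus x) z)).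
    by rewrite -uJM w_eq uJM lam_v'.
  by rewrite [uJ (OnePlus w) _]/uJ [uJ (OnePlus x) _]/uJ /= uJD !dualD => /addrI.
have Jw : (w \in Jright lam) = (x \in Jright (dual_comp lam (uJ_linear v))).
  apply/JrightP/JrightP => lam0 z; first by rewrite dual_compE -lam_w.
  by rewrite -[z]uJ1 -(mulgV v) uJM lam_w -(dual_compE lam (uJ_linear v)).
rewrite Jw dual_compE; case: (boolP (x \in _)) => [Jx | _]; last first.
  by rewrite !mulr0n !mulr0.
rewrite !mulr1n.
rewrite mulrCA mulKf //; congr (_ * eps _).
have := congr1 (fun u => lam (minus_one u)) w_eq; rewrite /= !dualD.
have /JrightP-> : w \in Jright lam by rewrite Jw.
rewrite addr0 => e; apply: (addIr (lam (minus_one v))); rewrite e.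
have /= := lam_v' x; rewrite /uJ !dualD => /addrI->.
by rewrite Hgroup_Ad ?groupV // -addrA addrC.
Qed.

Lemma chi_formula a h x :
  chi eps a (hx E h x) = (#|G0_group E (tag a)| * #|J|)%:R^-1 *
    \sum_r theta a (r * h * r^-1)%g * orbit_sum (tag a) (Ad E r x).
Proof.
rewrite cfIndE ?subsetT // natrM invfM -mulrA; congr (_ * _).
rewrite mulr_sumr (eq_bigl xpredT) => [|g]; last by rewrite inE.
rewrite sum_hx (reindex_inj invg_inj); apply: eq_bigr => r _ /=.
transitivity (\sum_u xi eps (theta a) (hx E h x ^ (iL E r^-1 * iU E u))%g).
  by rewrite sum_algebraGroup.
rewrite -xi_conjU_sum (reindex_inj invg_inj); apply: eq_bigr => u _ /=.
rewrite -hx_conjL -iLV -iUV /conjg.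
by rewrite invMg !invgK !mulgA.
Qed.

(** xi is afforded by a representation affording phi, inflated to G_0 and twisted
    by the linear character eps^(lam(x)). *)
Lemma xi_character lam (phi : 'CF(Hgroup E lam)) :
  phi \is a character -> xi eps phi \is a character.
Proof.
case/char_reprP=> [[n rG]] ->{phi}; apply/char_reprP.
pose rho (g : extGroup E) := eps (lam (Jpart g)) *: rG (Lpart g).
have rho_repr : mx_repr (G0_group E lam) rho.
  split.
    have -> : 1%g = hx E 1 0 by rewrite -iL_hx [iL _ _]morph1.
    by rewrite /rho Jpart_hx Lpart_hx dual0 addchar0 scale1r repr_mx1.
  move=> _ _ /imset2P[h x Hh Jx ->] /imset2P[k y Hk Jy ->].
  rewrite hxM /rho !Jpart_hx !Lpart_hx repr_mxM // !dualD.
  have /JrightP-> := Jright_Ad (groupVr Hk) Jx.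
  rewrite addr0 Hgroup_Ad ?groupV // addcharD.
  by rewrite -scalemxAl -scalemxAr scalerA.
exists (Representation (MxRepresentation rho_repr)); apply/cfun_inP=> g.
case/imset2P=> h x Hh Jx ->; rewrite xiE // !cfunE /= Hh mulr1n.
by rewrite mem_G0 Hh Jx /rho Jpart_hx Lpart_hx mxtraceZ mulr1n mulrC.
Qed.

Lemma theta_character a : theta a \is a character.
Proof. by apply: rpred_sum => i _; apply: irr_char. Qed.

Lemma chi_character a : chi eps a \is a character.
Proof. by rewrite cfInd_char // xi_character // theta_character. Qed.

Lemma chi_neq0 a : tagged a != set0 -> chi eps a != 0.
Proof.
case/set0Pn=> i ai; rewrite cfInd_eq0 ?subsetT ?xi_character ?theta_character //.
have theta1 : theta a 1%g != 0.
  rewrite sum_cfunE (bigD1 i) //= gt_eqF // ltr_wpDr ?irr1_gt0 //.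
  by apply: sumr_ge0 => j _; apply/ltW/irr1_gt0.
apply: contraNneq theta1 => /cfunP/(_ (hx E 1 0)).
rewrite xi_formula // dual0 addchar0 mulr1 cfunE.
by rewrite Jright0 mulr1n => ->.
Qed.

End CharacterFormula.

(** * Invariant characters of normal subgroups *)
Section InvariantCharacters.

Import GroupScope.
Local Open Scope ring_scope.

Variables (gT : finGroupType) (H S : {group gT}).
Hypothesis nsHS : H <| S.

(** Conjugation by t maps the S-orbit of 'chi_i onto an S'-orbit of irreducible
    characters of H'. It coincides with the orbit of 'chi_j or is disjoint from
    it, and then orthogonality of the irreducible characters applies. *)
Lemma orbit_irr_sums_conj (t : gT) (H' S' : {group gT}) i j :
    H' = (H :^ t)%G -> S' = (S :^ t)%G ->
    let phi := \sum_(k in cfclass_Iirr S i) 'chi[H]_k in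
    let psi := \sum_(k in cfclass_Iirr S' j) 'chi[H']_k in
  (forall h, psi h = phi (t * h * t^-1)%g)
  \/ \sum_h phi h * (psi (t^-1 * h * t)%g)^* = 0.
Proof.
move=> defH' defS' phi psi; rewrite {}defH' {}defS' in j psi *.
pose tau : Iirr H -> Iirr (H :^ t) := isom_Iirr (conj_isom H t).
have tauE k h : 'chi_(tau k) (t^-1 * h * t)%g = 'chi_k h.
  have [Hh | nHh] := boolP (h \in H).
    by rewrite isom_IirrE -mulgA -conjgE -(conjgmE H) cfIsomE.
  by rewrite !cfun0 // -mulgA -conjgE memJ_conjg.
have nSH y : y \in S -> y \in 'N(H) by apply/subsetP/normal_norm.
have tau_conj k y : y \in S -> tau (conjg_Iirr k y) = conjg_Iirr (tau k) (y ^ t)%g.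
  move=> Sy; apply/irr_inj/cfunP=> h; rewrite -[h](conjgKV t); move: (h ^ _)%g => {}h.
  rewrite {1}conjgE mulgA tauE !conjg_IirrE !cfConjgE ?nSH ?normJ ?memJ_conjg ?nSH //.
  by rewrite -conjVg -conjJg -(tauE k) -mulgA -conjgE.
have tau_class : tau @: cfclass_Iirr S i = cfclass_Iirr (S :^ t) (tau i).
  apply/setP=> k; apply/imsetP/imsetP=> [[_ /imsetP[y Sy ->] ->] | [z]].
    by exists (y ^ t)%g; rewrite ?memJ_conjg ?tau_conj.
  rewrite mem_conjg => Sz ->; exists (conjg_Iirr i (z ^ t^-1)%g).
    exact: imset_f.
  by rewrite tau_conj // conjgKV.
pose phi' := \sum_(k in cfclass_Iirr (S :^ t) (tau i)) 'chi_k.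
have phi'E h : phi' (t^-1 * h * t)%g = phi h.
  rewrite /phi' -tau_class big_imset => [|k l _ _]; last exact: isom_Iirr_inj.
  by rewrite !sum_cfunE; apply: eq_bigr => k _; apply: tauE.
have [tau_ij | tau_ij] := boolP (tau i \in cfclass_Iirr (S :^ t) j).
  left=> h; rewrite -phi'E !mulgA mulVg mul1g mulgKV /psi /phi'.
  by move: tau_ij; rewrite -eq_cfclass_IirrE => /eqP->.
right; under eq_bigr => h _ do rewrite -phi'E -mulgA -conjgE.
transitivity (\sum_h phi' h * (psi h)^*).
  by rewrite [RHS](reindex_inj (conjg_inj t)).
have: '[phi', psi] = 0.
  rewrite cfdot_suml big1 // => k tau_ik; rewrite cfdot_sumr big1 // => l jl.
  rewrite cfdot_irr; case: eqP => // kl; case/negP: tau_ij.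
  rewrite -eq_cfclass_IirrE; move: tau_ik jl.
  by rewrite -!eq_cfclass_IirrE kl => /eqP-> /eqP->.
rewrite cfdotE => /eqP; rewrite mulf_eq0 invr_eq0 (negbTE (neq0CG _)) /= => /eqP.
rewrite big_mkcond /= => e; rewrite -[RHS]e; apply: eq_bigr => h _.
by case: ifPn => // nHh; rewrite cfun0 ?mul0r.
Qed.

(** An S-invariant class function has the same inner product with all the
    irreducible characters in an S-orbit, hence is orthogonal to each of them as
    soon as it is orthogonal to their sum. *)
Lemma orbit_irr_sums_separate (D : gT -> algC) :
    (forall s h, s \in S -> h \in H -> D (h ^ s)%g = D h) ->
    (forall i, \sum_(h in H) (\sum_(k in cfclass_Iirr S i) 'chi[H]_k) h * D h = 0) ->
  {in H, forall h, D h = 0}.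
Proof.
move=> D_inv D_orth.
have D_cf : is_class_fun <<H>> [ffun h => (D h)^* *+ (h \in H)].
  rewrite genGid; apply: intro_class_fun => [h s Hh Hs | h /negbTE->] //.
  by rewrite groupJ // Hh D_inv // (subsetP (normal_sub nsHS)).
pose psi := Cfun 0 D_cf.
have psiE h : h \in H -> psi h = (D h)^* by move=> Hh; rewrite cfunE Hh.
have psi_conj s : s \in S -> (psi ^ s)%CF = psi.
  move=> Ss; have nHs : s \in 'N(H) by apply: subsetP Ss; apply: normal_norm.
  apply/cfun_inP=> h Hh; rewrite cfConjgE // !psiE ?D_inv ?groupV //.
  by rewrite memJ_norm ?groupV.
have psi_irr i : '[psi, 'chi_i] = 0.
  apply/eqP; rewrite cfdotC fmorph_eq0.
  have dot_k k : k \in cfclass_Iirr S i -> '['chi_k, psi] = '['chi_i, psi].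
    by case/imsetP=> y Sy ->; rewrite conjg_IirrE -{1}(psi_conj y Sy) cfConjg_iso.
  have: '[\sum_(k in cfclass_Iirr S i) 'chi_k, psi] = 0.
    rewrite cfdotE; under eq_bigr => h Hh do rewrite psiE // conjCK.
    by rewrite D_orth mulr0.
  rewrite cfdot_suml (eq_bigr _ dot_k) sumr_const => /eqP.
  rewrite mulrn_eq0 => /orP[/eqP O0 | //].
  by have := card0_eq O0 i; rewrite cfclass_IirrE cfclass_refl.
move=> h Hh; apply/eqP; rewrite -conjC_eq0 -psiE // [psi]cfun_sum_cfdot.
by rewrite big1 ?cfunE // => i _; rewrite psi_irr scale0r.
Qed.

End InvariantCharacters.

(** * Superclass functions, orthogonality and completeness *)
Section SuperclassFunctions.

Variables (F : finFieldType) (L : finGroupType) (J : nilAlgebra F).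
Variables (E : algebraGroupExt L J) (eps : addChar F).
Implicit Types (h k r p s : L) (x y z : J) (u v : algebraGroup J) (lam mu : dual J).
Implicit Types (a b : A0_index E) (f : extGroup E -> algC) (X : {set dual J}).

(** The functions constant on superclasses, described by invariances so that
    sums over G can be reindexed along them. *)
Definition superclass_function f : Prop :=
  [/\ forall p h x, f (hx E (p * h * p^-1)%g (Ad E p x)) = f (hx E h x),
      forall h u x v, f (hx E h (uJ u (Ju x v))) = f (hx E h x)
    & forall h x y, y \in Jh E h -> f (hx E h (x + y)) = f (hx E h x)].

Lemma superclass_function_conj f :
  superclass_function f -> superclass_function (fun g => (f g)^*).
Proof. by case=> fL fU fJ; split=> *; rewrite ?fL ?fU ?fJ. Qed.

Lemma superclass_function_chi a : superclass_function (chi eps a).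
Proof.
split=> [p h x | h u x v | h x y Jy]; rewrite !chi_formula; congr (_ * _).
- rewrite [RHS](reindex_inj (mulIg p)) /=; apply: eq_bigr => r _.
  by rewrite -AdM invMg !mulgA.
- apply: eq_bigr => r _; congr (_ * _).
  by rewrite Ad_uJ Ad_Ju orbit_sum_uJ orbit_sum_Ju.
apply: eq_bigr => r _.
have [Hh | nHh] := boolP (r * h * r^-1 \in Hgroup E (tag a))%g; last first.
  by rewrite (cfun0 (theta a) nHh) !mul0r.
by rewrite AdD (orbit_sum_shift eps _ Hh) // Jh_Ad.
Qed.

(** The Fourier transform of f along J at lam, paired with theta along L. *)
Definition fourier_coef f a :=
  \sum_h \sum_x theta a h * eps (tag a x) * f (hx E h x).

Lemma uJ_Ju_inj u v : injective (fun x => uJ u (Ju x v)).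
Proof.
apply: (can_inj (g := fun x => uJ u^-1%g (Ju x v^-1%g))) => x.
by rewrite -uJ_Ju -uJM mulVg uJ1 -JuM mulgV Ju1.
Qed.

Definition chi_scale a : algC :=
  (#|G0_group E (tag a)| * #|J|)%:R^-1 * (#|L| * #|J| ^ 2)%:R.

Lemma chi_scale_neq0 a : chi_scale a != 0.
Proof.
have J0 : (0 < #|J|)%N by rewrite (cardD1 0).
have L0 : (0 < #|L|)%N by rewrite (cardD1 1%g).
rewrite mulf_neq0 ?invr_neq0 // pnatr_eq0 -lt0n muln_gt0 ?expn_gt0 ?J0 ?L0 //.
by rewrite cardG_gt0.
Qed.

(** Each of the substitutions averaged over in [chi_formula] and [orbit_sum],
    namely conjugation by r and x |-> v x u, leaves f unchanged and can be undone by
    reindexing the sum. *)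
Lemma sum_chi_superclass_function a f : superclass_function f ->
  \sum_g chi eps a g * f g = chi_scale a * fourier_coef f a.
Proof.
case=> fL fU _; rewrite sum_hx /chi_scale -mulrA.
have orbit_sum_coef : \sum_h \sum_x theta a h * orbit_sum eps (tag a) x * f (hx E h x)
    = (#|J| ^ 2)%:R * fourier_coef f a.
  rewrite mulr_sumr; apply: eq_bigr => h _.
  under eq_bigr => x _ do rewrite mulrAC mulr_sumr.
  rewrite exchange_big -mulnn natrM -mulrA !mulr_natl -!card_algebraGroup /=.
  rewrite -sumr_const; apply: eq_big => // v _.
  under eq_bigr => x _ do rewrite mulr_sumr.
  rewrite exchange_big -sumr_const; apply: eq_big => // u _ /=.
  rewrite [RHS](reindex_inj (@uJ_Ju_inj v u)); apply: eq_bigr => x _ /=.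
  by rewrite fU mulrAC.
rewrite [(#|L| * _)%:R]natrM -[_%:R * _ * _]mulrA -orbit_sum_coef mulr_natl -sumr_const.
under eq_bigr => h _.
  under eq_bigr => x _ do rewrite chi_formula -mulrA mulr_suml.
  rewrite -mulr_sumr; over.
rewrite -mulr_sumr; congr (_ * _).
under eq_bigr => h _ do rewrite exchange_big.
rewrite exchange_big; apply: eq_bigr => r _ /=.
rewrite (reindex_inj (conjg_inj r)); apply: eq_bigr => h _ /=.
rewrite (reindex_inj (@Ad_inj _ _ _ E r^-1%g)); apply: eq_bigr => x _ /=.
(* The sums over h and x have been reindexed by conjugation by r^-1;
   undoing it on f is the invariance of f under L. *)
have rhr : (r * h ^ r * r^-1 = h)%g by rewrite conjgE !mulgA mulgV mul1g mulgK.
by rewrite AdKV rhr -(fL r) rhr AdKV.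
Qed.

Lemma A0_conjP r a b :
  reflect (UlamU (Adstar E r (tag a)) = UlamU (tag b) /\
             forall h, theta b h = theta a (r^-1 * h * r)%g)
          (A0_conj r a b).
Proof.
rewrite /A0_conj Adstar_UlamU; apply: (iffP andP) => -[/eqP e].
  by move/forallP=> th; split=> // h; apply/eqP.
by move=> th; rewrite e; split=> //; apply/forallP=> h; rewrite th.
Qed.

Lemma UlamU_Adstar r lam mu : UlamU lam = UlamU mu ->
  UlamU (Adstar E r lam) = UlamU (Adstar E r mu).
Proof. by rewrite -!Adstar_UlamU => ->. Qed.

Lemma A0_conj_sym r a b : A0_conj r a b -> A0_conj r^-1%g b a.
Proof.
case/A0_conjP=> ab th; apply/A0_conjP; split=> [|h].
  by rewrite -(UlamU_Adstar r^-1 ab) AdstarK.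
by rewrite th invgK !mulgA mulVg mul1g mulgKV.
Qed.

Lemma A0_conj_trans r s a b c :
  A0_conj r a b -> A0_conj s b c -> A0_conj (s * r)%g a c.
Proof.
case/A0_conjP=> ab th_b /A0_conjP[bc th_c]; apply/A0_conjP; split=> [|h].
  by rewrite AdstarM (UlamU_Adstar s ab).
by rewrite th_c th_b invMg !mulgA.
Qed.

Lemma sum_eps_superclass_function f lam mu h : superclass_function f ->
  mu \in UlamU lam ->
  \sum_x eps (mu x) * f (hx E h x) = \sum_x eps (lam x) * f (hx E h x).
Proof.
case=> _ fU _ /mem_UlamU[u [v muE]].
rewrite [RHS](reindex_inj (@uJ_Ju_inj v u)); apply: eq_bigr => x _.
by rewrite muE fU.
Qed.

Lemma fourier_coef_A0_conj r f a b : superclass_function f -> A0_conj r a b ->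
  fourier_coef f b = fourier_coef f a.
Proof.
move=> scf /A0_conjP[ab th]; have [fL fU _] := scf.
have b_a : tag b \in UlamU (Adstar E r (tag a)) by rewrite ab UlamU_refl.
rewrite /fourier_coef (reindex_inj (conjg_inj r^-1%g)); apply: eq_bigr => h _ /=.
under eq_bigr => x _ do rewrite -mulrA.
rewrite -mulr_sumr (sum_eps_superclass_function _ scf b_a) th conjgE invgK.
rewrite !mulgA mulVg mul1g mulgKV mulr_sumr (reindex_inj (@Ad_inj _ _ _ E r)).
by apply: eq_bigr => x _ /=; rewrite Adstar_Ad AdK fL mulrA.
Qed.

(** Conjugation by s carries H and S of the first orbit to H and S of the second,
    so that two S-irreducible characters are being compared, and they are
    different because s does not conjugate a to b. *)
Lemma theta_orthogonal X s a b : a \in A0 E X -> b \in A0 E X ->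
    UlamU (Adstar E s (tag a)) = UlamU (tag b) -> ~~ A0_conj s a b ->
  \sum_h theta a h * (theta b (s * h * s^-1)%g)^* = 0.
Proof.
rewrite !inE => /andP[_ /existsP[i /eqP a_i]] /andP[_ /existsP[j /eqP b_j]] ab.
have s_ab : Adstar E s (tag a) \in UlamU (tag b) by rewrite -ab UlamU_refl.
have defH : Hgroup E (tag b) = (Hgroup E (tag a) :^ s^-1)%G.
  apply/val_inj/setP=> h; rewrite [LHS]/= mem_conjg invgK.
  rewrite -[RHS](Hgroup_conj E s) (Hgroup_eq E s_ab) /= !conjgE !mulgA mulgV mul1g.
  by rewrite mulgK.
have defS : Sgroup E (tag b) = (Sgroup E (tag a) :^ s^-1)%G.
  apply/val_inj/setP=> h; rewrite [LHS]/= mem_conjg invgK.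
  rewrite -[RHS](Sgroup_conj E s) /= ab conjgE !mulgA mulgV mul1g.
  by rewrite mulgK.
have nsHS : (Hgroup E (tag a) <| Sgroup E (tag a))%g by apply: astab_normal.
have [th | th0] := orbit_irr_sums_conj nsHS i j defH defS.
  case/negP; apply/A0_conjP; split=> // h.
  by rewrite /theta a_i b_j th invgK.
move=> _; rewrite -[RHS]th0 /theta a_i b_j; apply: eq_bigr => h _.
by rewrite invgK.
Qed.

(** Expanding the second character over L, U and U separates the variables h
    and x. The sum over x vanishes unless the functional mu below is zero, and
    mu = 0 means that s conjugates the orbit of a to that of b, in which case the
    sum over h vanishes. *)
Lemma chi_orthogonal X a b : a \in A0 E X -> b \in A0 E X ->
  (forall r, ~~ A0_conj r a b) -> '[chi eps a, chi eps b] = 0.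
Proof.
move=> A0a A0b nab; rewrite cfdotE (eq_bigl xpredT) => [|g]; last by rewrite inE.
have scf := superclass_function_conj (superclass_function_chi b).
rewrite (sum_chi_superclass_function _ scf); apply/eqP.
rewrite !mulf_eq0; apply/orP; right; apply/orP; right; apply/eqP.
have -> : fourier_coef (fun g => (chi eps b g)^*) a =
    (#|G0_group E (tag b)| * #|J|)%:R^-1 * \sum_s
    (\sum_h theta a h * (theta b (s * h * s^-1)%g)^*) *
    (\sum_v \sum_u \sum_x eps (tag a x - tag b (uJ v (Ju (Ad E s x) u)))).
  rewrite /fourier_coef.
  under eq_bigr => h _.
    under eq_bigr => x _.
      rewrite chi_formula rmorphM fmorphV rmorph_nat mulrCA rmorph_sum mulr_sumr.
      over.
    rewrite -mulr_sumr exchange_big; over.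
  rewrite -mulr_sumr exchange_big; congr (_ * _); apply: eq_bigr => s _ /=.
  rewrite mulr_suml; apply: eq_bigr => h _ /=.
  under [in RHS]eq_bigr => v _ do rewrite exchange_big.
  rewrite [in RHS]exchange_big mulr_sumr; apply: eq_bigr => x _ /=.
  rewrite rmorphM mulrACA /orbit_sum rmorph_sum; congr (_ * _); rewrite mulr_sumr.
  apply: eq_bigr => v _; rewrite rmorph_sum mulr_sumr; apply: eq_bigr => u _.
  by rewrite /= eps_conj addcharD.
rewrite big1 ?mulr0 // => s _; apply/eqP; rewrite mulf_eq0.
case: eqP => //= sum_theta; rewrite big1 // => v _; rewrite big1 // => u _.
pose mu := dual_lincomb (-1)
  (dual_comp (dual_comp (dual_comp (tag b) (uJ_linear v)) (Ju_linear u))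
             (Ad_linear E s)) (tag a).
have muE x : mu x = tag a x - tag b (uJ v (Ju (Ad E s x) u)).
  by rewrite dual_lincombE !dual_compE mulN1r addrC.
under eq_bigr => x _ do rewrite -muE.
rewrite sum_eps_dual; case: ifP => // /forallP mu0.
case: sum_theta; apply: (theta_orthogonal A0a A0b) => //.
apply/UlamU_eq/mem_UlamU; exists u; exists v => x.
apply/eqP; rewrite Adstar_Ad -subr_eq0 -{2}[x](AdKV E s) -muE.
exact: mu0.
Qed.

(** By Fourier inversion it is enough that the transform of f in x vanishes at all
    lam and h, which is seen separately for h outside and inside H_(U lam U). *)
Lemma superclass_function_complete X f : is_transversal X (dual_orbits J) [set: dual J] ->
  superclass_function f -> {in A0 E X, forall a, fourier_coef f a = 0} ->
  forall g, f g = 0.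
Proof.
move=> trX scf coef0 g; have [fL fU fJ] := scf.
rewrite -(hx_parts g); move: (Lpart g) (Jpart g) => h {g}.
apply: (fourier_inj (eps := eps)) => lam; under eq_bigr => x _ do rewrite mulrC.
have [Hh | nHh] := boolP (h \in Hgroup E lam); last first.
  have [y Jy lam_y] : exists2 y, y \in Jh E h & lam y != 0.
    apply/exists_inP; apply: contraR nHh => /exists_inPn lam0.
    by apply/Hgroup_JhP=> y /lam0; rewrite negbK => /eqP.
  have [c nc] := exists_scalar_eps_neq1 eps lam_y.
  have Jcy : c *: y \in Jh E h.
    have [/is_subspaceP[J0 JL] _ _] := is_idealP _ (Jh_ideal E h).
    by rewrite -[_ *: _]addr0 JL.
  (* Translation by c y multiplies the sum by a scalar different from 1. *)
  set S := \sum_x _; have: S = eps (lam (c *: y)) * S.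
    rewrite {1}/S (reindex_inj (addIr (c *: y))) mulr_sumr.
    by apply: eq_bigr => x _; rewrite fJ // dualD addcharD mulrA [_ * eps _]mulrC.
  rewrite dualZ => /eqP; rewrite -subr_eq0 -{1}[S]mul1r -mulrBl mulf_eq0.
  by rewrite subr_eq0 eq_sym (negbTE nc) => /eqP.
(* For h in the group, lam may be replaced by the representative in X of its
   orbit, to which the hypothesis on the coefficients applies. *)
have [lam0 X0 lam_0] : exists2 lam0, lam0 \in X & lam \in UlamU lam0.
  have lam_orb : UlamU lam \in dual_orbits J by apply: imset_f.
  exists (transversal_repr lam X (UlamU lam)).
    exact: (repr_mem_transversal trX).
  by rewrite (UlamU_eq (repr_mem_pblock trX lam lam_orb)) UlamU_refl.
rewrite (sum_eps_superclass_function _ scf lam_0).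
move: h Hh; rewrite (Hgroup_eq E lam_0).
apply: (orbit_irr_sums_separate (astab_normal _ _)) => [s h Ss Hh | i].
  rewrite -[LHS](sum_eps_superclass_function _ scf (SgroupP E lam0 s Ss)).
  rewrite (reindex_inj (@Ad_inj _ _ _ E s^-1%g)); apply: eq_bigr => x _ /=.
  by rewrite Adstar_Ad invgK AdKV conjgE mulgA -{2}[s]invgK fL.
pose a : A0_index E := Tagged (fun lam => {set Iirr (Hgroup E lam)})
  (cfclass_Iirr (Sgroup E lam0) i).
have A0a : a \in A0 E X by rewrite inE X0; apply/existsP; exists i.
rewrite -[RHS](coef0 a A0a) [RHS](bigID (mem (Hgroup E lam0))) /= [X in _ + X]big1.
  rewrite addr0; apply: eq_bigr => h _; rewrite mulr_sumr.
  by apply: eq_bigr => x _; rewrite mulrA.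
by move=> h nHh; rewrite big1 // => x _; rewrite (cfun0 (theta a) nHh) !mul0r.
Qed.

End SuperclassFunctions.

(** * Superclasses as fibres *)
Section Superclasses.

Variables (F : finFieldType) (L : finGroupType) (J : nilAlgebra F).
Variables (E : algebraGroupExt L J).
Implicit Types (h k r p s : L) (x y z : J) (u v : algebraGroup J) (I : {set J}).
Implicit Types (g : extGroup E) (b : B0_index L J).

Lemma jcoset_eq I x y : is_ideal I -> (jcoset I x == jcoset I y) = (x - y \in I).
Proof.
move=> idI; have I0 := ideal0 idI; apply/eqP/idP=> [e | Ixy].
  have : x \in jcoset I y by rewrite -e; apply/imsetP; exists 0; rewrite ?addr0.
  by case/imsetP=> z Iz ->; rewrite addrC addKr.
apply/setP=> z; apply/imsetP/imsetP=> -[w Iw ->].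
  by exists (x - y + w); [rewrite idealD | rewrite addrA subrKC].
exists (- (x - y) + w); first by rewrite idealD ?idealN.
by rewrite opprB addrA subrKC.
Qed.

Lemma mem_UcosetU I x0 x : is_ideal I ->
  reflect (exists u v, exists2 y, y \in I & x = uJ u (Ju x0 v) + y)
          (jcoset I x \in UcosetU I x0).
Proof.
move=> idI; apply: (iffP imset2P) => [[u v _ _ /eqP] | [u [v [y Iy ->]]]].
  rewrite jcoset_eq // => Id; exists u; exists v; exists (x - uJ u (Ju x0 v)) => //.
  by rewrite subrKC.
by exists u v => //; apply/eqP; rewrite jcoset_eq // addrC addKr.
Qed.

Lemma UcosetU_eq I x0 x : is_ideal I ->
  reflect (UcosetU I x = UcosetU I x0) (jcoset I x \in UcosetU I x0).
Proof.
move=> idI; have refl_U y : jcoset I y \in UcosetU I y.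
  apply/mem_UcosetU=> //; exists 1%g; exists 1%g; exists 0; first exact: ideal0.
  by rewrite Ju1 uJ1 addr0.
have trans_U y z w : jcoset I y \in UcosetU I z -> jcoset I z \in UcosetU I w ->
    jcoset I y \in UcosetU I w.
  case/mem_UcosetU=> // u [v [i Ii ->]] /mem_UcosetU[//|u' [v' [j Ij ->]]].
  apply/mem_UcosetU=> //; exists (u * u')%g; exists (v' * v)%g.
  exists (uJ u (Ju j v) + i); first by rewrite idealD ?ideal_uJ ?ideal_Ju.
  by rewrite JuD uJD -addrA -uJ_Ju uJM JuM.
have sym_U y z : jcoset I y \in UcosetU I z -> jcoset I z \in UcosetU I y.
  case/mem_UcosetU=> // u [v [i Ii ->]].
  apply/mem_UcosetU=> //; exists u^-1%g; exists v^-1%g.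
  exists (- uJ u^-1%g (Ju i v^-1%g)); first by rewrite idealN ?ideal_uJ ?ideal_Ju.
  by rewrite JuD uJD addrK -uJ_Ju -JuM mulgV Ju1 -uJM mulVg uJ1.
apply: (iffP idP) => [x_x0 | <- //].
have sub_U y z : jcoset I y \in UcosetU I z -> UcosetU I y \subset UcosetU I z.
  move=> yz; apply/subsetP=> C yC; have /imset2P[u v _ _ defC] := yC.
  by rewrite defC in yC *; apply: trans_U yz.
by apply/eqP; rewrite eqEsubset !sub_U // sym_U.
Qed.

Definition class_of g : B0_index L J :=
  (Lpart g, UcosetU (Jh E (Lpart g)) (Jpart g)).

Lemma class_of_hx h x : class_of (hx E h x) = (h, UcosetU (Jh E h) x).
Proof. by rewrite /class_of Lpart_hx Jpart_hx. Qed.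

Lemma class_of_B0 g : class_of g \in B0 E.
Proof. by rewrite inE; apply: imset_f. Qed.

Lemma B0_class_of b : b \in B0 E -> exists g, b = class_of g.
Proof.
rewrite inE; case: b => h O /= /imsetP[x _ ->].
by exists (hx E h x); rewrite class_of_hx.
Qed.

Lemma Ad_Jh p h : [set Ad E p x | x in Jh E h] = Jh E (p * h * p^-1)%g.
Proof.
apply/setP=> y; apply/imsetP/idP=> [[x Jx ->] | Jy]; first exact: Jh_Ad.
exists (Ad E p^-1%g y); last by rewrite AdKV.
by have := Jh_Ad p^-1%g Jy; rewrite invgK !mulgA mulVg mul1g mulgKV.
Qed.

Lemma Ad_jcoset p h x :
  [set Ad E p y | y in jcoset (Jh E h) x] = jcoset (Jh E (p * h * p^-1)%g) (Ad E p x).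
Proof.
rewrite /jcoset -imset_comp -Ad_Jh -imset_comp; apply: eq_imset => y /=.
exact: AdD.
Qed.

Lemma B0_conj_class_of p h x :
  B0_conj E p (class_of (hx E h x)) = class_of (hx E (p * h * p^-1)%g (Ad E p x)).
Proof.
rewrite !class_of_hx /B0_conj /=; congr (_, _).
apply/setP=> C; apply/imsetP/imset2P => [[_ /imset2P[u v _ _ ->] ->] | [u v _ _ ->]].
  exists (Ad_group E p u) (Ad_group E p v) => //.
  by rewrite Ad_jcoset Ad_uJ Ad_Ju.
exists (jcoset (Jh E h) (uJ (Ad_group E p^-1%g u) (Ju x (Ad_group E p^-1%g v)))).
  by apply/imset2P; exists (Ad_group E p^-1 u) (Ad_group E p^-1 v).
by rewrite Ad_jcoset Ad_uJ Ad_Ju !Ad_groupKV.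
Qed.

Lemma class_of_conj p g :
  class_of (iL E p * g * (iL E p)^-1)%g = B0_conj E p (class_of g).
Proof. by rewrite -(hx_parts g) hx_conjL B0_conj_class_of. Qed.

Lemma mem_superclass b g : b \in B0 E ->
  (g \in superclass E b) = (class_of g \in [set B0_conj E p b | p : L]).
Proof.
case/B0_class_of=> g0 ->{b}; apply/bigcupP/imsetP => -[p _].
  case/imsetP=> x; rewrite inE => Cx ->; exists p => //; rewrite class_of_conj.
  congr (B0_conj E p _); rewrite class_of_hx; congr (_, _).
  by apply/UcosetU_eq; rewrite ?Jh_ideal.
move=> g_g0; exists p => //; apply/imsetP.
pose g1 := ((iL E p)^-1 * g * iL E p)%g.
have g1_g0 : class_of g1 = class_of g0.
  rewrite /g1 iLV -[X in (_ * X)%g]invgK iLV class_of_conj g_g0 -!class_of_conj.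
  by rewrite -!iLV invgK !mulgA mulVg mul1g mulgKV.
exists (Jpart g1).
  by rewrite inE -g1_g0; apply/UcosetU_eq; rewrite ?Jh_ideal.
rewrite -g1_g0 /= hx_parts /g1.
by rewrite !mulgA mulgV mul1g mulgK.
Qed.

(** The label in [B_orbits E] whose superclass contains g ([superclass_fibre]). *)
Definition orbit_of g : {set B0_index L J} := [set B0_conj E p (class_of g) | p : L].

Lemma B0_conj_orbit p g :
  [set B0_conj E r (B0_conj E p (class_of g)) | r : L] = orbit_of g.
Proof.
have conjM r : B0_conj E r (B0_conj E p (class_of g)) = B0_conj E (r * p)%g (class_of g).
  rewrite -!class_of_conj; congr class_of.
  by rewrite [iL E (r * p)]morphM ?inE // invMg !mulgA.
apply/setP=> b; apply/imsetP/imsetP=> -[r _ ->]; first by exists (r * p)%g.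
by exists (r * p^-1)%g; rewrite // conjM mulgKV.
Qed.

Lemma mem_orbit_of g : class_of g \in orbit_of g.
Proof.
apply/imsetP; exists 1%g => //.
by rewrite -class_of_conj [iL E 1]morph1 mul1g invg1 mulg1.
Qed.

Lemma B_orbitsP (beta : {set B0_index L J}) :
  reflect (exists g, beta = orbit_of g) (beta \in B_orbits E).
Proof.
apply: (iffP imsetP) => [[b /B0_class_of[g ->] ->] | [g ->]]; first by exists g.
by exists (class_of g); rewrite ?class_of_B0.
Qed.

(** Conjugating h(1 + x) by p in L conjugates the associated pair by p, so the
    superclass of a pair consists of the elements with pair in the same L-orbit. *)
Lemma superclass_fibre b g0 : b \in orbit_of g0 ->
  superclass E b = [set g | orbit_of g == orbit_of g0].
Proof.
case/imsetP=> p _ ->; apply/setP=> g; rewrite inE mem_superclass; last first.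
  by rewrite -class_of_conj class_of_B0.
rewrite B0_conj_orbit; apply/idP/eqP=> [/imsetP[r _ g_g0] | <-]; last exact: mem_orbit_of.
by rewrite /orbit_of g_g0 B0_conj_orbit.
Qed.

Lemma orbit_of1 : [set g | orbit_of g == orbit_of 1%g] = [set 1%g].
Proof.
apply/setP=> g; rewrite !inE; apply/eqP/eqP=> [g_1 | -> //].
have := mem_orbit_of g; rewrite g_1 => /imsetP[p _].
rewrite -class_of_conj mulg1 mulgV.
have -> : 1%g = hx E 1 0 by rewrite -iL_hx [iL _ _]morph1.
rewrite -(hx_parts g); move: (Lpart g) (Jpart g) => h x.
rewrite !class_of_hx => -[-> /(UcosetU_eq _ _ (Jh_ideal _ _))].
case/(mem_UcosetU _ _ (Jh_ideal _ _))=> u [v [y]]; rewrite Jh1 => /set1P-> ->.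
by rewrite /Ju mul0j /uJ !(addr0, jmul0).
Qed.

Lemma superclass_function_class_of (f : extGroup E -> algC) g1 g2 :
  superclass_function f -> class_of g1 = class_of g2 -> f g1 = f g2.
Proof.
case=> _ fU fJ; rewrite -(hx_parts g1) -(hx_parts g2).
move: (Lpart g1) (Jpart g1) (Lpart g2) (Jpart g2) => h x h' y; rewrite !class_of_hx.
case=> <- /(UcosetU_eq _ _ (Jh_ideal _ _)).
case/(mem_UcosetU _ _ (Jh_ideal _ _))=> u [v [z Jz ->]].
by rewrite fJ.
Qed.

Lemma superclass_function_orbit_of (f : extGroup E -> algC) g1 g2 :
  superclass_function f -> orbit_of g1 = orbit_of g2 -> f g1 = f g2.
Proof.
move=> scf g12; have := mem_orbit_of g1; rewrite g12 => /imsetP[p _].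
rewrite -class_of_conj => /(superclass_function_class_of scf)->.
by case: scf => fL _ _; rewrite -(hx_parts g2) hx_conjL fL.
Qed.

Lemma superclass_function_comp_orbit_of (c : {set B0_index L J} -> algC) :
  superclass_function (fun g => c (orbit_of g)).
Proof.
have orbit_eq h x y : jcoset (Jh E h) y \in UcosetU (Jh E h) x ->
    orbit_of (hx E h y) = orbit_of (hx E h x).
  by move/(UcosetU_eq _ _ (Jh_ideal E h)) => e; rewrite /orbit_of !class_of_hx e.
split=> [p h x | h u x v | h x y Jy]; congr (c _).
- by rewrite /orbit_of -B0_conj_class_of B0_conj_orbit.
- apply/orbit_eq/mem_UcosetU; first exact: Jh_ideal.
  by exists u; exists v; exists 0; rewrite ?addr0 ?ideal0 ?Jh_ideal.
apply/orbit_eq/mem_UcosetU; first exact: Jh_ideal.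
by exists 1%g; exists 1%g; exists y; rewrite ?uJ1 ?Ju1.
Qed.

(** On each superclass phi is a constant, which comes out of the sum. *)
Lemma sum_superclass_function0 (f phi : extGroup E -> algC) :
    superclass_function phi ->
    (forall g0, \sum_(g | orbit_of g == orbit_of g0) f g = 0) ->
  \sum_g f g * phi g = 0.
Proof.
move=> scphi f0; rewrite (partition_big orbit_of xpredT) //= big1 // => beta _.
have [g0 /eqP <- | no_g] := pickP (fun g => orbit_of g == beta); last first.
  by rewrite big_pred0.
under eq_bigr => g /eqP gg0 do rewrite (superclass_function_orbit_of scphi gg0).
by rewrite -mulr_suml f0 mul0r.
Qed.

End Superclasses.

(** * As many characters as superclasses *)
Section Counting.

Variables (F : finFieldType) (L : finGroupType) (J : nilAlgebra F).
Variables (E : algebraGroupExt L J) (eps : addChar F) (X : {set dual J}).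
Variable repA : {set A0_index E} -> A0_index E.
Hypothesis trX : is_transversal X (dual_orbits J) [set: dual J].
Hypothesis repA_in :
  {in A_orbits E X, forall alpha : {set A0_index E}, repA alpha \in alpha}.

(** The relation [A0_conj] being an equivalence, alpha is the class of its
    representative. *)
Lemma repA_spec alpha : alpha \in A_orbits E X ->
  repA alpha \in A0 E X /\
  alpha = [set b in A0 E X | [exists r, A0_conj r (repA alpha) b]].
Proof.
move=> A_alpha; have := repA_in A_alpha; case/imsetP: A_alpha => a0 A0a0.
move: (repA alpha) => a defalpha; rewrite defalpha in_set.
case/andP=> A0a /existsP[r a0a]; split=> //; apply/setP=> b; rewrite !in_set.
congr (_ && _); apply/existsP/existsP=> -[s]; last first.
  by move/(A0_conj_trans a0a); exists (s * r)%g.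
by move/(A0_conj_trans (A0_conj_sym a0a)); exists (s * r^-1)%g.
Qed.

Lemma A_orbit_conj a : a \in A0 E X ->
  exists2 alpha, alpha \in A_orbits E X & exists r, A0_conj r a (repA alpha).
Proof.
move=> A0a; set alpha := [set b in A0 E X | [exists r, A0_conj r a b]].
have A_alpha : alpha \in A_orbits E X by apply/imsetP; exists a.
exists alpha => //; have := repA_in A_alpha.
by rewrite in_set => /andP[_ /existsP].
Qed.

Lemma chi_repA_orthogonal alpha beta :
    alpha \in A_orbits E X -> beta \in A_orbits E X -> alpha != beta ->
  '[chi eps (repA alpha), chi eps (repA beta)] = 0.
Proof.
move=> Aalpha Abeta nab.
have [A0a defa] := repA_spec Aalpha; have [A0b defb] := repA_spec Abeta.
apply: (chi_orthogonal eps A0a A0b) => r; apply: contra nab => ab.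
rewrite defa defb; apply/eqP/setP=> c; rewrite !in_set; congr (_ && _).
apply/existsP/existsP=> -[s]; last first.
  by move/(A0_conj_trans ab); exists (s * r)%g.
by move/(A0_conj_trans (A0_conj_sym ab)); exists (s * r^-1)%g.
Qed.

Lemma chi_repA_neq0 alpha : alpha \in A_orbits E X -> chi eps (repA alpha) != 0.
Proof.
case/repA_spec; rewrite inE => /andP[_ /existsP[i /eqP tag_i]] _.
apply: chi_neq0; apply/set0Pn; exists i.
by rewrite tag_i cfclass_IirrE cfclass_refl.
Qed.

Definition class_sums : 'M[algC]_(#|A_orbits E X|, #|B_orbits E|) :=
  \matrix_(i, j) \sum_(g | orbit_of g == enum_val j) chi eps (repA (enum_val i)) g.

(** A relation between the rows says that a combination of the characters has sum
    zero over each superclass, hence is orthogonal to all superclass functions, in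
    particular to the characters themselves; these being orthogonal, its
    coefficients vanish. *)
Lemma class_sums_row_free : row_free class_sums.
Proof.
apply: inj_row_free => v vM0; apply/rowP=> i0; rewrite mxE.
pose chi_ (i : 'I_#|A_orbits E X|) := chi eps (repA (enum_val i)).
have A_ (i : 'I_#|A_orbits E X|) : enum_val i \in A_orbits E X by apply: enum_valP.
have dot0 : \sum_(g : extGroup E) (\sum_i v 0 i * chi_ i g) * (chi_ i0 g)^* = 0.
  apply: sum_superclass_function0 => [|g0].
    exact/superclass_function_conj/superclass_function_chi.
  have B_g0 : orbit_of g0 \in B_orbits E by apply/B_orbitsP; exists g0.
  have /rowP/(_ (enum_rank_in B_g0 (orbit_of g0))) := vM0; rewrite !mxE => e.
  rewrite -[RHS]e exchange_big; apply: eq_bigr => i _ /=.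
  by rewrite mxE mulr_sumr enum_rankK_in.
have: v 0 i0 * '[chi_ i0] = 0.
  rewrite -(mulr0 #|[set: extGroup E]|%:R^-1) -dot0.
  rewrite cfdotE mulrCA; congr (_ * _).
  under [RHS]eq_bigr => g _ do rewrite mulr_suml.
  rewrite exchange_big (bigD1 i0) //= [X in _ + X]big1 ?addr0 => [|i ii0].
    rewrite mulr_sumr; apply: eq_big => [g|g _]; first by rewrite inE.
    by rewrite mulrA.
  have /eqP : '[chi_ i, chi_ i0] = 0.
    by apply: chi_repA_orthogonal; rewrite // (inj_eq enum_val_inj).
  rewrite cfdotE mulf_eq0 invr_eq0 (negbTE (neq0CG _)) /= => /eqP e.
  under eq_bigr => g _ do rewrite -mulrA.
  rewrite -mulr_sumr (eq_bigl (fun g => g \in [set: extGroup E])) => [|g].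
    by rewrite e mulr0.
  by rewrite inE.
by move/eqP; rewrite mulf_eq0 cfnorm_eq0 (negbTE (chi_repA_neq0 (A_ i0))) orbF => /eqP.
Qed.

(** A relation between the columns says that the superclass function f with the
    given values is orthogonal to all the characters, hence is zero. *)
Lemma class_sums_trmx_row_free : row_free class_sums^T.
Proof.
apply: inj_row_free => v vM0; apply/rowP=> j0; rewrite mxE.
pose f (g : extGroup E) := \sum_j v 0 j *+ (orbit_of g == enum_val j).
have scf : superclass_function f.
  exact: (@superclass_function_comp_orbit_of _ _ _ E
           (fun beta => \sum_j v 0 j *+ (beta == enum_val j))).
have /B_orbitsP[g0 def_j0] : enum_val j0 \in B_orbits E by apply: enum_valP.
have: f g0 = 0.
  apply: (superclass_function_complete (eps := eps) trX scf) => a.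
  case/A_orbit_conj=> alpha A_alpha [r ab].
  rewrite -(fourier_coef_A0_conj eps scf ab).
  have: \sum_g chi eps (repA alpha) g * f g = 0.
    have /rowP/(_ (enum_rank_in A_alpha alpha)) := vM0; rewrite !mxE => e.
    rewrite -[RHS]e; under eq_bigr => g _ do rewrite mulr_sumr.
    rewrite exchange_big; apply: eq_bigr => j _ /=.
    rewrite !mxE enum_rankK_in // mulr_sumr [RHS]big_mkcond; apply: eq_bigr => g _.
    by rewrite mulrb; case: ifP; rewrite ?mulr0 // mulrC.
  rewrite (sum_chi_superclass_function _ _ scf) => /eqP.
  by rewrite mulf_eq0 (negbTE (chi_scale_neq0 _)) => /eqP.
rewrite /f -def_j0 (bigD1 j0) //= eqxx big1 ?addr0 // => j jj0.
by rewrite (inj_eq enum_val_inj) eq_sym (negbTE jj0).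
Qed.

Lemma card_A_orbits : #|A_orbits E X| = #|B_orbits E|.
Proof.
apply/eqP; rewrite eqn_leq; apply/andP; split.
  by rewrite -(eqP class_sums_row_free) rank_leq_col.
by rewrite -(eqP class_sums_trmx_row_free) rank_leq_col.
Qed.

End Counting.

Theorem theorem5p1 (F : finFieldType) (L : finGroupType) (J : nilAlgebra F)
    (E : algebraGroupExt L J) (eps : addChar F) (X : {set dual J})
    (repA : {set A0_index E} -> A0_index E)
    (repB : {set B0_index L J} -> B0_index L J)
    (X_repr : is_transversal X (dual_orbits J) [set: dual J])
    (repA_in : {in A_orbits E X, forall alpha : {set A0_index E}, repA alpha \in alpha})
    (repB_in : {in B_orbits E, forall beta : {set B0_index L J}, repB beta \in beta}) :
  supercharacter_theory
    [seq chi eps (repA alpha) | alpha <- enum (A_orbits E X)]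
    [seq superclass E (repB beta) | beta <- enum (B_orbits E)].
Proof.
have fibre (g0 : extGroup E) :
    superclass E (repB (orbit_of g0)) = [set g | orbit_of g == orbit_of g0].
  by apply: superclass_fibre; apply: repB_in; apply/B_orbitsP; exists g0.
have memK B : reflect (exists g0 : extGroup E, B = [set g | orbit_of g == orbit_of g0])
    (B \in [seq superclass E (repB beta) | beta <- enum (B_orbits E)]).
  apply: (iffP mapP) => [[beta] | [g0 ->]].
    by rewrite mem_enum => /B_orbitsP[g0 ->] ->; exists g0; rewrite fibre.
  exists (orbit_of g0); last by rewrite fibre.
  by rewrite mem_enum; apply/B_orbitsP; exists g0.
split.
- split.
    by move=> _ /mapP[alpha _ ->]; apply: chi_character.
  have chi0 : 0 \notin [seq chi eps (repA alpha) | alpha <- enum (A_orbits E X)].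
    apply/mapP=> -[alpha]; rewrite mem_enum => /(chi_repA_neq0 eps repA_in) n0 /esym/eqP.
    exact/negP.
  apply/pairwise_orthogonalP; split.
    rewrite /= chi0 map_inj_in_uniq ?enum_uniq // => alpha beta.
    rewrite !mem_enum => A_alpha A_beta e; apply/eqP; apply: contraT => nab.
    have /eqP := chi_repA_orthogonal eps repA_in A_alpha A_beta nab.
    by rewrite -e cfnorm_eq0 (negbTE (chi_repA_neq0 eps repA_in A_alpha)).
  move=> _ _ /mapP[alpha + ->] /mapP[beta + ->]; rewrite !mem_enum => A_alpha A_beta ne.
  by apply: (chi_repA_orthogonal eps repA_in) => //; apply: contraNneq ne => ->.
- split.
    rewrite map_inj_in_uniq ?enum_uniq // => beta1 beta2; rewrite !mem_enum.
    case/B_orbitsP=> g1 ->{beta1} /B_orbitsP[g2 ->]; rewrite !fibre.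
    by move/setP/(_ g1); rewrite !inE eqxx => /esym/eqP.
  apply/and3P; split.
  + rewrite eqEsubset subsetT /=; apply/subsetP=> g _; apply/bigcupP.
    exists [set k | orbit_of k == orbit_of g]; last by rewrite inE.
    by rewrite inE; apply/memK; exists g.
  + apply/trivIsetP=> A B; rewrite !inE => /memK[g1 ->] /memK[g2 ->] nAB.
    rewrite -setI_eq0; apply: contraNT nAB => /set0Pn[g].
    by rewrite !inE => /andP[/eqP-> /eqP->].
  rewrite inE; apply/memK=> -[g0 /esym/eqP/set0Pn[]].
  by exists g0; rewrite inE.
- by rewrite !size_map -!cardE; apply: (card_A_orbits eps X_repr repA_in).
- move=> _ B /mapP[alpha _ ->] /memK[g0 ->] g k; rewrite !inE => /eqP gg0 /eqP kg0.
  apply: (superclass_function_orbit_of (superclass_function_chi eps (repA alpha))).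
  by rewrite gg0.
by apply/memK; exists 1%g; rewrite orbit_of1.
Qed.
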